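(* Let $0<\beta<1$, $0<\alpha<\alpha+\beta<n$, and let $b$ be a locally integrable function on $\mathbb{Q}_p^n$. Then the following statements are equivalent: (C.1) $b\in\Lambda_\beta(\mathbb{Q}_p^n)$ and $b\ge0$. (C.2) The commutator $[b,\mathcal{M}_\alpha^p]$ is bounded from $L^r(\mathbb{Q}_p^n)$ to $L^q(\mathbb{Q}_p^n)$ for all $r,q$ with $1<r<\frac{n}{\alpha+\beta}$ and $1/q=1/r-(\alpha+\beta)/n$. (C.3) The commutator $[b,\mathcal{M}_\alpha^p]$ is bounded from $L^r(\mathbb{Q}_p^n)$ to $L^q(\mathbb{Q}_p^n)$ for some $r,q$ with $1<r<\frac{n}{\alpha+\beta}$ and $1/q=1/r-(\alpha+\beta)/n$. (C.4) There exist some $r,q$ with $1<r<\frac{n}{\alpha+\beta}$ and $1/q=1/r-(\alpha+\beta)/n$ such that $$\sup_{\gamma\in\mathbb{Z},\,x\in\mathbb{Q}_p^n}\frac{1}{|B_\gamma(x)|_h^{\beta/n}}\Big(\frac{1}{|B_\gamma(x)|_h}\int_{B_\gamma(x)}\Big|b(y)-|B_\gamma(x)|_h^{-\alpha/n}\mathcal{M}_{\alpha,B_\gamma(x)}^p(b)(y)\Big|^q\,dy\Big)^{1/q}<\infty.$$ (C.5) For all $r,q$ with $1<r<\frac{n}{\alpha+\beta}$ and $1/q=1/r-(\alpha+\beta)/n$, the displayed supremum in (C.4) is finite.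
   Context: Let $p$ be a prime, $n\ge1$, $\mathbb{Q}_p$ the field of $p$-adic numbers with $p$-adic absolute value $|\cdot|_p$, and $\mathbb{Q}_p^n$ equipped with $|x|_p=\max_{1\le j\le n}|x_j|_p$. For $\gamma\in\mathbb{Z}$ and $a\in\mathbb{Q}_p^n$, $B_\gamma(a)=\{x\in\mathbb{Q}_p^n:|x-a|_p\le p^\gamma\}$. Haar measure on $\mathbb{Q}_p^n$ is normalized by $|B_0(0)|_h=1$, so $|B_\gamma(a)|_h=p^{n\gamma}$; $|E|_h$ is the Haar measure of $E$ and $dx$ denotes integration against it. $L^q(\mathbb{Q}_p^n)$ is the usual Lebesgue space for this measure. Functions are real-valued, and as usual functions equal almost everywhere are identified in function spaces. Fractional maximal function: for $0\le\alpha<n$ and $f$ measurable, $\mathcal{M}_\alpha^p(f)(x)=\sup_{\gamma\in\mathbb{Z}}|B_\gamma(x)|_h^{-1+\alpha/n}\int_{B_\gamma(x)}|f(y)|\,dy$. For a fixed ball $B_*$, $\mathcal{M}_{\alpha,B_*}^p(f)(x)=\sup_{\gamma\in\mathbb{Z}:\,B_\gamma(x)\subset B_*}|B_\gamma(x)|_h^{-1+\alpha/n}\int_{B_\gamma(x)}|f(y)|\,dy$ for $x\in B_*$. Nonlinear commutator: $[b,\mathcal{M}_\alpha^p](f)(x)=b(x)\mathcal{M}_\alpha^p(f)(x)-\mathcal{M}_\alpha^p(bf)(x)$. An operator $T$ is bounded from a normed function space $X$ to $Y$ if there is a constant $C$ with $\|Tf\|_Y\le C\|f\|_X$ for all $f\in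 X$. Lipschitz space ($0<\beta<1$): $\Lambda_\beta(\mathbb{Q}_p^n)$ is the set of measurable $f$ with $\|f\|_{\Lambda_\beta(\mathbb{Q}_p^n)}=\sup_{x\ne y}\frac{|f(x)-f(y)|}{|x-y|_p^\beta}<\infty$. *)

(* Defs.v *)
From HB Require Import structures.
From mathcomp Require Import all_boot all_order all_algebra.
From mathcomp Require Import all_classical all_reals all_analysis.
From mathcomp Require Import measurable_realfun.

Set Implicit Arguments.
Unset Strict Implicit.
Unset Printing Implicit Defensive.
Import Order.TTheory GRing.Theory Num.Theory.
Local Open Scope classical_set_scope.
Local Open Scope ring_scope.

(* |x|_p = p ^ (- v(x)), the valuation being read off the reduced fraction. *)
Definition rat_padic_abs (p : nat) (x : rat) : rat :=
  if x == 0 then 0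
  else p%:R ^ ((logn p `|denq x|)%:Z - (logn p `|numq x|)%:Z).

Section RatPadicAbs.
Context (p : nat) (hp : prime p).
Local Notation abs := (rat_padic_abs p).

Let p_gt0 : 0 < p%:R :> rat.
Proof. by rewrite ltr0n prime_gt0. Qed.

Let p_neq0 : p%:R != 0 :> rat.
Proof. by rewrite gt_eqF. Qed.

Lemma rat_padic_abs0 : abs 0 = 0.
Proof. by rewrite /rat_padic_abs eqxx. Qed.

Lemma rat_padic_abs_ge0 x : 0 <= abs x.
Proof. by rewrite /rat_padic_abs; case: ifP => // _; rewrite exprz_ge0 ?ltW. Qed.

Lemma rat_padic_abs_gt0 x : x != 0 -> 0 < abs x.
Proof. by rewrite /rat_padic_abs => /negPf ->; rewrite exprz_gt0. Qed.

Lemma rat_padic_abs_frac (a d : int) : a != 0 -> d != 0 ->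
  abs (a%:~R / d%:~R) = p%:R ^ ((logn p `|d|)%:Z - (logn p `|a|)%:Z).
Proof.
move=> a0 d0; set x := _ / _.
have x0 : x != 0 by rewrite mulf_neq0 ?invr_neq0 ?intr_eq0.
rewrite /rat_padic_abs (negPf x0); congr (_ ^ _).
have E : (numq x * d = a * denq x)%R.
  apply: (@intr_inj rat); rewrite !intrM.
  have := divq_num_den x; rewrite {2}/x => /eqP.
  by rewrite eqr_div ?intr_eq0 ?denq_neq0 // => /eqP.
have := congr1 (fun z : int => logn p `|z|%N) E.
rewrite !abszM !lognM ?absz_gt0 ?numq_eq0 ?denq_neq0 // => H.
by apply/eqP; rewrite subr_eq addrAC eq_sym subr_eq -!PoszD addnC H addnC.
Qed.

Lemma rat_padic_abs1 : abs 1 = 1.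
Proof.
have := @rat_padic_abs_frac 1 1; rewrite divr1 => -> //.
by rewrite subrr expr0z.
Qed.

Lemma rat_padic_absM x y : abs (x * y) = abs x * abs y.
Proof.
have [->|x0] := eqVneq x 0; first by rewrite !(mul0r, rat_padic_abs0).
have [->|y0] := eqVneq y 0; first by rewrite !(mulr0, rat_padic_abs0).
rewrite -{1}(divq_num_den x) -{1}(divq_num_den y) mulf_div -!intrM.
rewrite rat_padic_abs_frac ?mulf_neq0 ?numq_eq0 ?denq_neq0 //.
rewrite /rat_padic_abs (negPf x0) (negPf y0) -expfzDr //.
rewrite !abszM !lognM ?absz_gt0 ?numq_eq0 ?denq_neq0 //.
by rewrite !PoszD opprD addrACA.
Qed.

Lemma rat_padic_absN x : abs (- x) = abs x.
Proof.
by rewrite /rat_padic_abs oppr_eq0 numqN denqN abszN.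
Qed.

Lemma rat_padic_absV x : abs x^-1 = (abs x)^-1.
Proof.
have [->|x0] := eqVneq x 0; first by rewrite rat_padic_abs0 !invr0 rat_padic_abs0.
have ax : abs x != 0 by rewrite gt_eqF ?rat_padic_abs_gt0.
by apply: (mulfI ax); rewrite -rat_padic_absM !divff // rat_padic_abs1.
Qed.

Let ultra_int (a b d : int) : a != 0 -> b != 0 -> d != 0 -> a + b != 0 ->
  (logn p `|a| <= logn p `|b|)%N ->
  abs ((a + b)%:~R / d%:~R) <= abs (a%:~R / d%:~R).
Proof.
move=> a0 b0 d0 ab0 le_ab; rewrite !rat_padic_abs_frac //.
rewrite ler_eXz2l; last by rewrite ltr1n prime_gt1.
rewrite lerD2l lerN2 lez_nat -pfactor_dvdn ?absz_gt0 //.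
have qa : ((p ^ logn p `|a|)%:Z %| a)%Z by rewrite dvdzE /= pfactor_dvdnn.
have qb : ((p ^ logn p `|a|)%:Z %| b)%Z.
  by rewrite dvdzE /= (dvdn_trans (dvdn_exp2l p le_ab)) ?pfactor_dvdnn.
by have := rpredD qa qb; rewrite dvdzE.
Qed.

Lemma rat_padic_abs_ultra x y : abs (x + y) <= Num.max (abs x) (abs y).
Proof.
have [->|x0] := eqVneq x 0; first by rewrite add0r le_max lexx orbT.
have [->|y0] := eqVneq y 0; first by rewrite addr0 le_max lexx.
have [->|xy0] := eqVneq (x + y) 0.
  by rewrite rat_padic_abs0 le_max rat_padic_abs_ge0.
pose d := denq x * denq y.
have d0 : d != 0 by rewrite mulf_neq0 ?denq_neq0.
have dx : denq x != 0 by rewrite denq_neq0.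
have dy : denq y != 0 by rewrite denq_neq0.
pose a := numq x * denq y; pose b := numq y * denq x.
have xE : x = a%:~R / d%:~R.
  by rewrite /a /d !intrM -mulf_div divff ?intr_eq0 // mulr1 divq_num_den.
have yE : y = b%:~R / d%:~R.
  rewrite /b /d !intrM [X in _ / X]mulrC -mulf_div divff ?intr_eq0 //.
  by rewrite mulr1 divq_num_den.
have a0 : a != 0 by rewrite mulf_neq0 ?numq_eq0.
have b0 : b != 0 by rewrite mulf_neq0 ?numq_eq0.
have xyE : x + y = (a + b)%:~R / d%:~R by rewrite intrD mulrDl -xE -yE.
have ab0 : a + b != 0.
  by apply: contraNneq xy0 => ab; rewrite xyE ab mul0r.
have [le_ab|/ltnW le_ba] := leqP (logn p `|a|) (logn p `|b|).
  by rewrite le_max xyE {1}xE ultra_int.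
by rewrite le_max xyE (addrC a) {1}yE ultra_int ?orbT // addrC.
Qed.

Lemma rat_padic_absD_lt x y e : abs x < e -> abs y < e -> abs (x + y) < e.
Proof.
move=> xe ye; apply: le_lt_trans (rat_padic_abs_ultra x y) _.
by rewrite gt_max xe.
Qed.

Lemma rat_padic_absB_lt x y e : abs x < e -> abs y < e -> abs (x - y) < e.
Proof. by move=> xe ye; rewrite rat_padic_absD_lt ?rat_padic_absN. Qed.

Lemma rat_padic_absD x y : abs (x + y) <= abs x + abs y.
Proof.
apply: le_trans (rat_padic_abs_ultra x y) _.
by rewrite ge_max lerDl lerDr !rat_padic_abs_ge0.
Qed.

Lemma rat_padic_abs_dist x y : `|abs x - abs y| <= abs (x - y).
Proof.
rewrite ler_norml; apply/andP; split.
  rewrite lerNl opprB lerBlDl -(rat_padic_absN (x - y)) opprB.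
  by apply: le_trans (rat_padic_absD _ _); rewrite addrC subrK.
by rewrite lerBlDl; apply: le_trans (rat_padic_absD _ _); rewrite addrC subrK.
Qed.

End RatPadicAbs.

Section PadicCauchy.
Context (p : nat) (hp : prime p).
Local Notation abs := (rat_padic_abs p).

Let subACB (V : zmodType) (a b c d : V) : (a - b) - (c - d) = (a - c) - (b - d).
Proof. by rewrite !opprB addrACA [in RHS]addrACA [X in _ + X = _]addrC. Qed.

Let mulB_split (A : pzRingType) (a b c d : A) :
  a * b - c * d = a * (b - d) + (a - c) * d.
Proof. by rewrite mulrBr mulrBl addrA subrK. Qed.

Definition padic_cauchy : {pred nat -> rat} := fun u =>
  `[< forall e : rat, 0 < e -> exists N : nat, forall i j : nat,
        (N <= i)%N -> (N <= j)%N -> abs (u i - u j) < e >].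

Lemma padic_cauchy_bounded u : u \in padic_cauchy ->
  exists2 B : rat, 0 < B & exists N : nat, forall i : nat,
    (N <= i)%N -> abs (u i) < B.
Proof.
move=> /asboolP /(_ 1 ltr01)[N uN].
exists (1 + abs (u N)); first by rewrite ltr_wpDr // rat_padic_abs_ge0.
exists N => i Ni; rewrite -[u i](subrK (u N)).
apply: le_lt_trans (rat_padic_absD hp _ _) _.
by rewrite ltrD2r uN.
Qed.

Lemma padic_cauchy_subring : subring_closed padic_cauchy.
Proof.
split=> [|u v uC vC|u v uC vC].
- apply/asboolP => e e0; exists 0 => i j _ _.
  by rewrite subrr rat_padic_abs0.
- have /asboolP uP := uC; have /asboolP vP := vC.
  apply/asboolP => e e0.
  have [[N uN] [M vM]] := (uP e e0, vP e e0).
  exists (maxn N M) => i j; rewrite !geq_max => /andP[Ni Mi] /andP[Nj Mj].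
  have -> : (u - v) i - (u - v) j = (u i - u j) - (v i - v j).
    exact: subACB.
  by rewrite rat_padic_absB_lt ?uN ?vM.
- have [B B0 [N uB]] := padic_cauchy_bounded uC.
  have [C C0 [M vB]] := padic_cauchy_bounded vC.
  have /asboolP uP := uC; have /asboolP vP := vC.
  apply/asboolP => e e0.
  have [N' uN] := uP _ (divr_gt0 e0 C0).
  have [M' vM] := vP _ (divr_gt0 e0 B0).
  exists (maxn (maxn N M) (maxn N' M')) => i j.
  rewrite !geq_max => /andP[/andP[Ni Mi] /andP[N'i M'i]].
  move=> /andP[/andP[Nj Mj] /andP[N'j M'j]].
  have -> : (u * v) i - (u * v) j = u i * (v i - v j) + (u i - u j) * v j.
    exact: mulB_split.
  apply: rat_padic_absD_lt => //; rewrite rat_padic_absM //.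
    rewrite -[ltRHS](divfK (lt0r_neq0 B0)) [ltRHS]mulrC.
    by rewrite ltr_pM ?rat_padic_abs_ge0 ?uB ?vM.
  rewrite -[ltRHS](divfK (lt0r_neq0 C0)).
  by rewrite ltr_pM ?rat_padic_abs_ge0 ?uN ?vB.
Qed.

End PadicCauchy.

Local Open Scope quotient_scope.

Section Padic.
Context (p : nat) (hp : prime p).
Local Notation abs := (rat_padic_abs p).

Definition padic_cauchy_seq : Type := {u : nat -> rat | u \in padic_cauchy p}.

HB.instance Definition _ := SubChoice.on padic_cauchy_seq.
HB.instance Definition _ := GRing.SubChoice_isSubComNzRing.Build
  (nat -> rat) (mem (padic_cauchy p)) padic_cauchy_seq (padic_cauchy_subring hp).

Implicit Types u v w : padic_cauchy_seq.

Definition padic_null : {pred padic_cauchy_seq} := fun u =>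
  `[< forall e : rat, 0 < e -> exists N : nat, forall i : nat,
        (N <= i)%N -> abs (val u i) < e >].

Lemma padic_null_ideal : idealr_closed padic_null.
Proof.
split=> [||w u v uN vN].
- by apply/asboolP => e e0; exists 0 => i _; rewrite rmorph0 rat_padic_abs0.
- apply/negP => /asboolP /(_ 1 ltr01)[N /(_ N (leqnn N))].
  by rewrite rmorph1 rat_padic_abs1 // ltxx.
- have [B B0 [N wB]] := padic_cauchy_bounded hp (valP w).
  apply/asboolP => e e0.
  have /asboolP /(_ _ (divr_gt0 e0 B0))[M uM] := uN.
  have /asboolP /(_ _ e0)[K vK] := vN.
  exists (maxn N (maxn M K)) => i; rewrite !geq_max => /and3P[Ni Mi Ki].
  rewrite rmorphD rmorphM; apply: rat_padic_absD_lt => //; last exact: vK.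
  rewrite [abs _](rat_padic_absM hp) -[ltRHS](divfK (lt0r_neq0 B0)) mulrC.
  by rewrite ltr_pM ?rat_padic_abs_ge0 ?wB ?uM.
Qed.

HB.instance Definition _ :=
  isIdealr.Build padic_cauchy_seq padic_null padic_null_ideal.

(* The completion of [rat] for the p-adic absolute value: Cauchy sequences
   modulo null sequences. *)
Definition padic : Type := {ideal_quot padic_null}.

HB.instance Definition _ := GRing.ComNzRing.on padic.
HB.instance Definition _ := EqQuotient.on padic.

Lemma padic_cauchy_away0 u : u \notin padic_null ->
  exists2 e : rat, 0 < e & exists N : nat, forall i : nat,
    (N <= i)%N -> e <= abs (val u i).
Proof.
move=> /asboolPn/existsNP[e /not_implyP[e0 /forallNP uE]].
have /asboolP /(_ e e0)[N uN] := valP u.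
have /existsNP[k /not_implyP[Nk /negP]] := uE N; rewrite -leNgt => ek.
exists e => //; exists N => i Ni; rewrite leNgt; apply/negP => ie.
have := rat_padic_absD_lt hp (uN k i Nk Ni) ie.
by rewrite subrK ltNge ek.
Qed.

Lemma padic_cauchy_inv u : u \notin padic_null ->
  (fun i => (val u i)^-1) \in padic_cauchy p.
Proof.
move=> /padic_cauchy_away0[d d0 [N ud]].
apply/asboolP => e e0.
have /asboolP /(_ _ (mulr_gt0 e0 (mulr_gt0 d0 d0)))[M uM] := valP u.
exists (maxn N M) => i j; rewrite !geq_max => /andP[Ni Mi] /andP[Nj Mj].
have nz k : (N <= k)%N -> val u k != 0.
  move=> /ud; apply: contraTneq => ->.
  by rewrite rat_padic_abs0 -ltNge.
have -> : (val u i)^-1 - (val u j)^-1 =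
    (val u j - val u i) / (val u i * val u j).
  have [ui0 uj0] := (nz _ Ni, nz _ Nj).
  by rewrite mulrBl invfM mulrCA divff // mulr1 mulrA divff // mul1r.
rewrite rat_padic_absM // rat_padic_absV // rat_padic_absM //.
rewrite ltr_pdivrMr; last by rewrite mulr_gt0 ?rat_padic_abs_gt0 ?nz.
apply: lt_le_trans (uM _ _ Mj Mi) _.
by rewrite ler_pM2l // ler_pM ?ud // ltW.
Qed.

Lemma padic_unit (x : padic) : x != 0 -> exists y : padic, y * x = 1.
Proof.
elim/quotW: x => u; rewrite piE Quotient.equivE subr0 => u0.
pose v : padic_cauchy_seq := 
  exist (fun s : nat -> rat => s \in padic_cauchy p) _ (padic_cauchy_inv u0).
exists (\pi v); apply/eqP; rewrite !piE Quotient.equivE.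
have [d d0 [N ud]] := padic_cauchy_away0 u0.
apply/asboolP => e e0; exists N => i /ud di.
rewrite rmorphB rmorphM rmorph1.
change (abs ((val u i)^-1 * val u i - 1) < e).
rewrite mulVf ?subrr ?rat_padic_abs0 //.
by apply: contraTneq di => ->; rewrite rat_padic_abs0 -ltNge.
Qed.

Definition padic_inv (x : padic) : padic :=
  if x == 0 then 0 else xget 0 [set y | y * x = 1].

Lemma padic_mulVf (x : padic) : x != 0 -> padic_inv x * x = 1.
Proof.
move=> x0; rewrite /padic_inv (negPf x0).
exact: (@xgetPex padic 0 [set y | y * x = 1] (padic_unit x0)).
Qed.

Lemma padic_invr0 : padic_inv 0 = 0.
Proof. by rewrite /padic_inv eqxx. Qed.

HB.instance Definition _ :=
  GRing.ComNzRing_isField.Build padic padic_mulVf padic_invr0.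

(* The p-adic absolute value only takes the values 0 and p ^ k (k : int), so it
   is valued in [rat]; it is the limit of [rat_padic_abs p] along any
   representative of x. *)
Definition padic_abs (x : padic) : rat :=
  xget 0 [set c : rat | forall e : rat, 0 < e -> exists N : nat, forall i : nat,
    (N <= i)%N -> `|abs (val (repr x) i) - c| < e].

Let lim_uniq (s : nat -> rat) (c d : rat) :
  (forall e : rat, 0 < e -> exists N : nat, forall i : nat,
    (N <= i)%N -> `|s i - c| < e) ->
  (forall e : rat, 0 < e -> exists N : nat, forall i : nat,
    (N <= i)%N -> `|s i - d| < e) -> c = d.
Proof.
move=> sc sd; apply/eqP; rewrite -subr_eq0 -normr_le0.
apply/ler_addgt0Pl => e e0; rewrite addr0.
have e2 : 0 < e / 2 by rewrite divr_gt0.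
have [[N cN] [M dM]] := (sc _ e2, sd _ e2).
have := cN _ (leq_maxl N M); have := dM _ (leq_maxr N M).
move=> H1 H2; rewrite [e]splitr -(subrK (s (maxn N M)) c) -addrA.
by apply: le_trans (ler_normD _ _) _; rewrite lerD // ltW // distrC.
Qed.

Lemma padic_abs_pi u (e : rat) : 0 < e -> exists N : nat, forall i : nat,
  (N <= i)%N -> `|abs (val u i) - padic_abs (\pi u)| < e.
Proof.
have lim_ex v : exists c : rat, forall e : rat, 0 < e ->
    exists N : nat, forall i : nat, (N <= i)%N -> `|abs (val v i) - c| < e.
  have [/asboolP v0|/padic_cauchy_away0[d d0 [N vd]]] := boolP (v \in padic_null).
    exists 0 => d d0; have [N vN] := v0 _ d0; exists N => i Ni.
    by rewrite subr0 ger0_norm ?rat_padic_abs_ge0 // vN.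
  have /asboolP /(_ d d0)[M vM] := valP v.
  exists (abs (val v (maxn N M))) => {}e e0; exists (maxn N M) => i.
  rewrite geq_max => /andP[Ni Mi].
  suff -> : abs (val v i) = abs (val v (maxn N M)) by rewrite subrr normr0.
  have le_abs j k : (N <= j)%N -> (M <= j)%N -> (M <= k)%N ->
      abs (val v k) <= abs (val v j).
    move=> Nj Mj Mk; rewrite -[val v k](subrK (val v j)).
    apply: le_trans (rat_padic_abs_ultra hp _ _) _.
    by rewrite ge_max lexx andbT (le_trans (ltW (vM k j Mk Mj))) ?vd.
  by apply/eqP; rewrite eq_le !le_abs ?leq_maxl ?leq_maxr.
move=> e0.
have e2 : 0 < e / 2 by rewrite divr_gt0.
have [M rM] := xgetPex 0 (lim_ex (repr (\pi_padic u))) _ e2.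
have : u - repr (\pi_padic u) \in padic_null.
  by rewrite Quotient.idealrBE reprK.
move=> /asboolP /(_ _ e2)[N urN].
exists (maxn N M) => i; rewrite geq_max => /andP[Ni Mi].
rewrite [e]splitr -(subrK (abs (val (repr (\pi_padic u)) i)) (abs (val u i))).
rewrite -addrA; apply: le_lt_trans (ler_normD _ _) _.
apply: ltrD; last exact: rM.
apply: le_lt_trans (rat_padic_abs_dist hp _ _) _.
by have := urN i Ni; rewrite rmorphB.
Qed.

Lemma padic_abs_uniq u (c : rat) :
  (forall e : rat, 0 < e -> exists N : nat, forall i : nat,
    (N <= i)%N -> `|abs (val u i) - c| < e) -> padic_abs (\pi u) = c.
Proof. by apply: lim_uniq => e; exact: padic_abs_pi. Qed.

Lemma padic_abs0 : padic_abs 0 = 0.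
Proof.
have -> : 0 = \pi_padic 0 by rewrite piE.
apply: padic_abs_uniq => e e0; exists 0 => i _.
by rewrite rmorph0 rat_padic_abs0 subrr normr0.
Qed.

Lemma padic_abs_ge0 (x : padic) : 0 <= padic_abs x.
Proof.
elim/quotW: x => u; apply/ler_addgt0Pr => e /(padic_abs_pi u)[N /(_ N (leqnn N))].
rewrite ltr_norml => /andP[_]; rewrite ltrBlDl => /ltW; apply: le_trans.
exact: rat_padic_abs_ge0.
Qed.

Lemma padic_abs_eq0 (x : padic) : padic_abs x = 0 -> x = 0.
Proof.
elim/quotW: x => u u0; apply/eqP; rewrite piE Quotient.equivE subr0.
apply/asboolP => e /(padic_abs_pi u)[N uN]; exists N => i /uN.
by rewrite u0 subr0 ger0_norm ?rat_padic_abs_ge0.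
Qed.

Lemma padic_absN (x : padic) : padic_abs (- x) = padic_abs x.
Proof.
elim/quotW: x => u; have -> : - \pi_padic u = \pi_padic (- u) by rewrite piE.
apply: padic_abs_uniq => e /(padic_abs_pi u)[N uN]; exists N => i Ni.
by rewrite rmorphN [abs _]rat_padic_absN; exact: uN.
Qed.

Lemma padic_absD (x y : padic) :
  padic_abs (x + y) <= Num.max (padic_abs x) (padic_abs y).
Proof.
elim/quotW: x => u; elim/quotW: y => v.
have -> : \pi_padic u + \pi_padic v = \pi_padic (u + v) by rewrite piE.
apply/ler_addgt0Pr => e e0.
have e2 : 0 < e / 2 by rewrite divr_gt0.
have [[N uN] [M vM]] := (padic_abs_pi u e2, padic_abs_pi v e2).
have [K uvK] := padic_abs_pi (u + v) e2.
pose i := maxn N (maxn M K).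
have Ni : (N <= i)%N by rewrite leq_maxl.
have Mi : (M <= i)%N by rewrite !leq_max leqnn orbT.
have Ki : (K <= i)%N by rewrite !leq_max leqnn !orbT.
move: (uN i Ni) (vM i Mi) (uvK i Ki); rewrite rmorphD.
have := rat_padic_abs_ultra hp (val u i) (val v i).
move: (abs _) (abs (val u i)) (abs (val v i)) => c a b.
move: (padic_abs _) (padic_abs _) (padic_abs _) => C B A cab.
move=> /ltr_normlP[_ aA] /ltr_normlP[_ bB] /ltr_normlP[cC _].
rewrite opprB ltrBlDl in cC; rewrite ltrBlDl in aA; rewrite ltrBlDl in bB.
apply/ltW/(lt_le_trans cC); rewrite [X in _ <= _ + X]splitr addrA lerD2r.
apply: le_trans cab _; rewrite ge_max; apply/andP; split.
  by rewrite (le_trans (ltW aA)) // lerD2r le_max lexx.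
by rewrite (le_trans (ltW bB)) // lerD2r le_max lexx orbT.
Qed.

Definition padic_dist (x y : padic) : rat := padic_abs (x - y).

Lemma padic_distxx x : padic_dist x x = 0.
Proof. by rewrite /padic_dist subrr padic_abs0. Qed.

Lemma padic_dist_eq0 x y : padic_dist x y = 0 -> x = y.
Proof. by move=> /padic_abs_eq0/subr0_eq. Qed.

Lemma padic_distC x y : padic_dist x y = padic_dist y x.
Proof. by rewrite /padic_dist -padic_absN opprB. Qed.

Lemma padic_dist_triangle y x z :
  padic_dist x z <= padic_dist x y + padic_dist y z.
Proof.
rewrite /padic_dist -[x - z](subrKA y).
apply: le_trans (padic_absD _ _) _.
by rewrite ge_max lerDl lerDr !padic_abs_ge0.
Qed.

HB.instance Definition _ := isPointed.Build padic 0.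
HB.instance Definition _ := isMetric.Build rat padic
  padic_distxx padic_dist_eq0 padic_distC padic_dist_triangle.

End Padic.

Section PadicSpace.
Context (p : nat) (hp : prime p) (n : nat).

(* The topology is that of matrices over [padic], i.e. the one of the maximum
   norm; the measurable sets are the Borel sets. *)
Definition padic_space : Type := 'rV[padic hp]_n.

HB.instance Definition _ := GRing.Zmodule.on padic_space.
HB.instance Definition _ := PointedTopological.on padic_space.
HB.instance Definition _ := PseudoMetric.on padic_space.
HB.instance Definition _ := @isMeasurable.Build (sigma_display (@open padic_space))
  padic_space <<s @open padic_space >>
  (@sigma_algebra0 _ setT _) (@sigma_algebraC _ _) (@sigma_algebra_bigcup _ setT _).

Definition padic_norm (x : padic_space) : rat :=
  \big[Num.max/0]_(j < n) padic_abs (x 0 j).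

Definition padic_ball (gamma : int) (a : padic_space) : set padic_space :=
  [set x | padic_norm (x - a) <= p%:R ^ gamma].

End PadicSpace.

Section FractionalMaximal.
Context (R : realType) (p : nat) (hp : prime p) (n : nat).
Local Notation X := (padic_space hp n).
Context (mu : {measure set X -> \bar R}).
Implicit Types (alpha beta r q : R) (b f : X -> R).
Local Open Scope ereal_scope.

(* These two properties characterize the Haar measure among Borel measures;
   finiteness on compact sets follows from the normalization. *)
Definition normalized_haar : Prop :=
  (forall (a : X) (A : set X), measurable A ->
     mu [set (a + x)%R | x in A] = mu A) /\
  mu (padic_ball 0 (0%R : X)) = 1.

Definition padic_locally_integrable b : Prop :=
  measurable_fun setT b /\
  forall K : set X, compact K -> \int[mu]_(x in K) `|(b x)%:E| < +oo.

Definition frac_maximal alpha f (x : X) : \bar R :=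
  ereal_sup [set mu (padic_ball gamma x) `^ (-1 + alpha / n%:R)
                 * \int[mu]_(y in padic_ball gamma x) `|(f y)%:E|
            | gamma in [set: int]].

Definition frac_maximal_on (B : set X) alpha f (x : X) : \bar R :=
  ereal_sup [set mu (padic_ball gamma x) `^ (-1 + alpha / n%:R)
                 * \int[mu]_(y in padic_ball gamma x) `|(f y)%:E|
            | gamma in [set gamma : int | padic_ball gamma x `<=` B]].

(* Where [frac_maximal alpha (b \* f)] is infinite this is -oo, even if the
   first term is infinite as well, so that boundedness on a Lebesgue space
   forces the commutator to be well defined almost everywhere. *)
Definition frac_commutator b alpha f (x : X) : \bar R :=
  (b x)%:E * frac_maximal alpha f x - frac_maximal alpha (b \* f)%R x.

Definition bounded_Lfun r q (T : (X -> R) -> (X -> \bar R)) : Prop :=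
  exists C : R, forall f, f \in Lfun mu r%:E ->
    measurable_fun setT (T f) /\
    'N[mu]_q%:E[T f] <= C%:E * 'N[mu]_r%:E[EFin \o f].

Definition lipschitz_seminorm beta f : \bar R :=
  ereal_sup [set (`|f xy.1 - f xy.2|
                  / ratr (padic_norm (xy.1 - xy.2)) `^ beta)%:E%R
            | xy in [set xy : X * X | xy.1 != xy.2]].

(* Functions equal almost everywhere are identified, hence the representative
   g. *)
Definition lipschitz_space beta f : Prop :=
  exists g : X -> R, [/\ measurable_fun setT g,
    lipschitz_seminorm beta g < +oo & f = g %[ae mu]].

Definition admissible_exponents alpha beta r q : Prop :=
  (1 < r < n%:R / (alpha + beta) /\ q^-1 = r^-1 - (alpha + beta) / n%:R)%R.

Definition frac_oscillation b alpha beta q : \bar R :=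
  ereal_sup [set (let B := padic_ball gx.1 gx.2 in
      (mu B `^ (beta / n%:R))^-1
      * ((mu B)^-1
         * \int[mu]_(y in B)
             `|(b y)%:E - mu B `^ (- alpha / n%:R)
                          * frac_maximal_on B alpha b y| `^ q) `^ q^-1)
    | gx in [set: int * X]].

End FractionalMaximal.

(* Main.v *)
Require Import Defs.
From mathcomp Require Import all_boot all_order all_algebra.
From mathcomp Require Import all_classical all_reals all_analysis.
From mathcomp Require Import measurable_realfun ring lra.
Import Order.TTheory GRing.Theory Num.Theory.
Local Open Scope classical_set_scope.
Local Open Scope ring_scope.

Set Implicit Arguments.
Unset Strict Implicit.
Unset Printing Implicit Defensive.

(** The balls of a given radius partition the p-adic space into countably many
    sets of the same measure, the n-th power of the radius ([haar_ball]). An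
    inequality between integrals that holds on each of these balls therefore
    holds on every union of them ([ge0_le_integral_balls]), and this replaces the
    covering and differentiation arguments of Euclidean analysis.

    Let b be nonnegative and Hoelder of order beta. Comparing b(y) with b(x) in
    an average over a ball of radius p ^ g around x gains a factor p ^ (g beta),
    so the commutator applied to f is at most a constant times the fractional
    maximal function of f of order alpha + beta ([frac_commutator_le]). The latter
    maps L^r to L^q: Hedberg's inequality ([hedberg]) interpolates it between the
    maximal function of order 0 and the L^r norm, and the maximal function of
    order 0 is bounded on L^r because its weak-type inequality
    ([maximal_weak_type]) can be summed over dyadic levels
    ([maximal_strong_type]).

    Conversely, on a ball B the commutator applied to the indicator of B is, up to
    the factor |B|^(alpha/n), the function b - |B|^(-alpha/n) M_(alpha,B)(b)
    ([bounded_commutator_oscillation]), so boundedness for one pair of exponents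
    bounds the oscillation for that pair.

    Finally, let the oscillation be finite for one q. On B the function
    |B|^(-alpha/n) M_(alpha,B)(b) is at least the mean m of |b| over B, so the
    oscillation controls (m - b)^+ in mean; as the mean of b does not exceed m, it
    controls |b - m| as well ([mean_oscillation_bound]). The means of |b| over
    shrinking balls then converge at a geometric rate to a Hoelder function, which
    is nonnegative, and which equals b almost everywhere ([campanato_limit_ae]).
    No trace of the exponents is left in this conclusion, which closes the
    cycle. *)

(** * Rational approximation and digits of p-adic numbers *)

Section RationalApproximation.
Context (p : nat) (hp : prime p).
Local Notation abs := (rat_padic_abs p).

Let p_gt0 : 0 < p%:R :> rat.
Proof. by rewrite ltr0n prime_gt0. Qed.

Let p_gt1 : 1 < p%:R :> rat.
Proof. by rewrite ltr1n prime_gt1. Qed.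

Lemma const_padic_cauchy (x : rat) : (fun=> x) \in padic_cauchy p.
Proof.
by apply/asboolP => e e0; exists 0%N => i j _ _; rewrite subrr rat_padic_abs0.
Qed.

(* Primality of p enters the ring structure on Cauchy sequences but not their
   type, so the structure is named explicitly. *)
Local Notation cauchy_ring := (Defs_padic_cauchy_seq__canonical__GRing_ComNzRing hp).

Definition const_cauchy (x : rat) : cauchy_ring :=
  exist (fun s : nat -> rat => s \in padic_cauchy p) _ (const_padic_cauchy x).

Definition padic_of_rat (x : rat) : padic hp := (\pi_(padic hp) (const_cauchy x))%qT.

Lemma padic_of_ratB : {morph padic_of_rat : x y / x - y}.
Proof.
move=> x y; rewrite /padic_of_rat.
have -> : const_cauchy (x - y) = const_cauchy x - const_cauchy y by exact/val_inj.
by rewrite !piE.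
Qed.

Lemma padic_abs_of_rat (x : rat) : padic_abs (padic_of_rat x) = abs x.
Proof.
by apply: padic_abs_uniq => e e0; exists 0%N => i _ /=; rewrite subrr normr0.
Qed.

Lemma padic_of_rat_dense (x : padic hp) (e : rat) : 0 < e ->
  exists y : rat, padic_abs (x - padic_of_rat y) < e.
Proof.
elim/quotW: x => u e0.
have e2 : 0 < e / 2 by rewrite divr_gt0.
have /asboolP /(_ _ e2)[N uN] := valP u.
exists (val u N).
pose w : cauchy_ring := (u : cauchy_ring) - const_cauchy (val u N).
have -> : (\pi_(padic hp) u)%qT - padic_of_rat (val u N) = (\pi_(padic hp) w)%qT.
  by rewrite /padic_of_rat !piE.
have [M wM] := padic_abs_pi hp w e2.
have := wM _ (leq_maxr N M).
have : val w (maxn N M) = val u (maxn N M) - val u N by rewrite /w rmorphB.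
move=> -> /ltr_normlP[+ _]; rewrite opprB ltrBlDr => /lt_trans; apply.
by rewrite [ltRHS]splitr ltrD2l uN ?leq_maxl.
Qed.

Lemma rat_padic_abs_digit (i : nat) : (i < p)%N -> (0 < i)%N -> abs i%:R = 1.
Proof.
move=> ip i0.
have := @rat_padic_abs_frac p i%:Z 1; rewrite divr1 => -> //; last first.
  by rewrite -lt0n.
rewrite absz1 logn1 absz_nat lognE i0 hp /=.
by rewrite gtnNdvd //= subrr expr0z.
Qed.

(** The digit is a * v modulo p, for x = a / d in lowest terms and v an
    inverse of d modulo p: the hypothesis forces p not to divide d. *)
Lemma rat_padic_digit (x : rat) : abs x <= 1 ->
  exists2 i : nat, (i < p)%N & abs (x - i%:R) <= p%:R^-1.
Proof.
move=> x1.
have [->|x0] := eqVneq x 0.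
  by exists 0%N; rewrite ?prime_gt0 // subrr rat_padic_abs0 invr_ge0 ltW.
pose a := numq x; pose d := denq x.
have d0 : d != 0 by rewrite denq_neq0.
have a0 : a != 0 by rewrite numq_eq0.
have xE : x = a%:~R / d%:~R by rewrite divq_num_den.
have pd : coprime p `|d|.
  rewrite prime_coprime //; apply/negP => dvd_pd.
  move: x1; rewrite xE rat_padic_abs_frac // -[leRHS](expr0z p%:R).
  rewrite ler_eXz2l // subr_le0 lez_nat => le_da.
  have dvd_pa : (p %| `|a|)%N.
    have := pfactor_dvdn 1 hp (m := `|a|%N); rewrite absz_gt0 a0 expn1 => -> //.
    apply: leq_trans le_da; have := pfactor_dvdn 1 hp (m := `|d|%N).
    by rewrite absz_gt0 d0 expn1 => <-.
  have := coprime_num_den x; rewrite -/a -/d => /eqP cad.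
  have := dvdn_gcd p `|a|%N `|d|%N; rewrite dvd_pa dvd_pd cad dvdn1 => /eqP p1.
  by have := hp; rewrite p1.
have [[u v] /= uv] : exists uv : int * int, uv.1 * p%:Z + uv.2 * d = 1.
  have [u [v uv]] := Bezoutz p%:Z d; exists (u, v) => /=; rewrite uv.
  by apply/eqP; rewrite /gcdz absz_nat; move: pd; rewrite /coprime => /eqP ->.
pose i := `|(a * v %% p)%Z|%N.
have p0 : p%:Z != 0 by rewrite -lt0n prime_gt0.
have iE : i%:Z = (a * v %% p)%Z by rewrite /i gez0_abs ?modz_ge0.
exists i.
  by have := ltz_pmod (a * v) (d := p%:Z); rewrite -iE !ltz_nat prime_gt0 // => /(_ isT).
have pdvd : (p%:Z %| a - i%:Z * d)%Z.
  rewrite iE; have -> : (a * v %% p)%Z = a * v - (a * v %/ p)%Z * p%:Z.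
    by rewrite {2}(divz_eq (a * v) p) addrAC subrr add0r.
  have -> : a - (a * v - (a * v %/ p)%Z * p%:Z) * d =
            (a * u + (a * v %/ p)%Z * d) * p%:Z.
    rewrite -{1}[a]mulr1 -uv; move: (_ %/ _)%Z => t.
    by rewrite mulrDr mulrBl mulrDl -!mulrA opprB [p%:Z * d]mulrC addrACA subrr addr0.
  exact: dvdz_mull.
have -> : x - i%:R = (a - i%:Z * d)%:~R / d%:~R.
  by rewrite intrB intrM mulrBl -xE mulfK ?intr_eq0 //.
have [z|z] := eqVneq (a - i%:Z * d) 0.
  by rewrite z mul0r rat_padic_abs0 invr_ge0 ltW.
rewrite rat_padic_abs_frac // -exprN1 ler_eXz2l //.
have -> : logn p `|d| = 0%N by rewrite lognE hp absz_gt0 d0 /=; move: pd; rewrite prime_coprime // => /negPf ->.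
rewrite sub0r lerN2 lez_nat -pfactor_dvdn ?absz_gt0 // expn1.
Qed.

Lemma rat_padic_absX_p (g : int) : abs (p%:R ^ g) = p%:R ^ (- g).
Proof.
have pp : p%:Z != 0 by rewrite -lt0n prime_gt0.
have h : forall k : nat, abs (p%:R ^+ k) = p%:R ^- k.
  elim=> [|k IH]; first by rewrite expr0 rat_padic_abs1 ?invr1.
  rewrite !exprS rat_padic_absM // IH.
  have -> : abs p%:R = p%:R^-1.
    have := @rat_padic_abs_frac p p%:Z 1; rewrite divr1 => -> //.
    by rewrite absz1 logn1 absz_nat logn_prime // eqxx sub0r exprN1.
  by rewrite invfM.
case: g => k; first by rewrite -exprnP h exprnN.
by rewrite NegzE opprK -exprnN rat_padic_absV // h invrK.
Qed.

(** Leading digit of a p-adic number of absolute value at most p ^ g: after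
    approximation by a rational number, it is read off the residue modulo p. *)
Lemma padic_digit (g : int) (x : padic hp) : padic_abs x <= p%:R ^ g ->
  exists i : 'I_p, padic_abs (x - padic_of_rat (i%:R * p%:R ^ (- g))) <= p%:R ^ (g - 1).
Proof.
move=> xg.
have pg k : 0 < p%:R ^ k :> rat by rewrite exprz_gt0.
have [y /ltW xy] := padic_of_rat_dense x (pg (g - 1)).
have yg : abs y <= p%:R ^ g.
  rewrite -padic_abs_of_rat -(subrK x (padic_of_rat y)).
  apply: le_trans (padic_absD _ _) _; rewrite ge_max xg andbT -padic_absN opprB.
  by rewrite (le_trans xy) // ler_eXz2l // gerBl.
have [|i ip yi] := rat_padic_digit (x := y * p%:R ^ g).
  by rewrite rat_padic_absM // rat_padic_absX_p -invr_expz mulrC ler_pdivrMl // mulr1.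
exists (Ordinal ip) => /=.
rewrite -(subrKA (padic_of_rat y)); apply: le_trans (padic_absD _ _) _.
rewrite ge_max xy /= -padic_of_ratB padic_abs_of_rat.
have -> : y - i%:R * p%:R ^ (- g) = (y * p%:R ^ g - i%:R) * p%:R ^ (- g).
  by rewrite mulrBl -mulrA -expfzDr ?gt_eqF // subrr expr0z mulr1.
rewrite rat_padic_absM // rat_padic_absX_p opprK expfzDr ?gt_eqF // mulrC.
by rewrite exprN1 ler_wpM2l // ltW.
Qed.

Lemma padic_digit_uniq (g : int) (i j : 'I_p) :
  padic_abs (padic_of_rat (i%:R * p%:R ^ (- g)) -
             padic_of_rat (j%:R * p%:R ^ (- g)) : padic hp) <= p%:R ^ (g - 1) -> i = j.
Proof.
have pg k : 0 < p%:R ^ k :> rat by rewrite exprz_gt0.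
wlog ji : i j / (j <= i)%N.
  move=> H; have [/H|ij] := leqP j i; first exact.
  by rewrite -padic_absN opprB => /(H _ _ (ltnW ij)).
rewrite -padic_of_ratB padic_abs_of_rat -mulrBl rat_padic_absM //.
rewrite rat_padic_absX_p opprK expfzDr ?gt_eqF // mulrC exprN1 ler_pM2l //.
move=> ij; apply/val_inj/eqP; rewrite eqn_leq ji andbT leqNgt.
apply/negP => lji; move: ij; rewrite -natrB // rat_padic_abs_digit ?subn_gt0 //.
  by rewrite lt_geF // invf_lt1.
by rewrite (leq_ltn_trans (leq_subr _ _)).
Qed.

Lemma rat_between_powers (t : rat) : 0 < t -> exists g : int, p%:R ^ g < t <= p%:R ^ (g + 1).
Proof.
move=> t0.
have p1' : 1 < p%:R :> rat by rewrite ltr1n prime_gt1.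
have big (s : rat) : s < p%:R ^+ (Num.bound s).
  apply: lt_le_trans (upper_nthrootP (leqnn _)) _.
  by rewrite lerXn2r ?nnegrE ?ler_nat ?prime_gt1.
pose N := Num.bound t^-1.
have tN : p%:R ^ (- N%:Z) < t.
  by rewrite -invr_expz -[ltRHS]invrK ltf_pV2 ?posrE ?invr_gt0 ?exprz_gt0 //.
have ex : exists k : nat, t <= p%:R ^ (k%:Z - N%:Z).
  exists (Num.bound t + N)%N; rewrite PoszD addrK; exact/ltW/big.
have [[|k] tk kmin] := ex_minnP ex; first by move: tk; rewrite sub0r leNgt tN.
exists (k%:Z - N%:Z); rewrite addrAC -PoszD addn1 tk andbT ltNge.
by apply/negP => /kmin; rewrite ltnn.
Qed.

End RationalApproximation.

(** * Ultrametric geometry of the p-adic space *)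

Section PadicGeometry.
Context (p : nat) (hp : prime p) (n : nat).
Local Notation X := (padic_space hp n).
Implicit Types (x y z : X) (g : int) (E : set X).

Let pX_gt0 g : 0 < p%:R ^ g :> rat.
Proof. by rewrite exprz_gt0 // ltr0n prime_gt0. Qed.

Let pX_ge0 g : 0 <= p%:R ^ g :> rat.
Proof. exact: ltW. Qed.

Let p_gt1 : 1 < p%:R :> rat.
Proof. by rewrite ltr1n prime_gt1. Qed.

Lemma padic_norm_leP x (c : rat) : 0 <= c ->
  padic_norm x <= c <-> forall j, padic_abs (x 0 j) <= c.
Proof.
move=> c0; split=> [/bigmax_leP[_ H] j|H]; first exact: H.
by apply/bigmax_leP; split.
Qed.

Lemma padic_norm_ge0 x : 0 <= padic_norm x.
Proof. exact: bigmax_ge_id. Qed.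

Lemma padic_normN x : padic_norm (- x) = padic_norm x.
Proof. by apply: eq_bigr => j _; rewrite mxE padic_absN. Qed.

Lemma padic_normD x y : padic_norm (x + y) <= Num.max (padic_norm x) (padic_norm y).
Proof.
apply/padic_norm_leP => [|j]; first by rewrite le_max padic_norm_ge0.
rewrite mxE; apply: le_trans (padic_absD _ _) _; rewrite ge_max !le_max.
have h z : padic_abs (z 0 j) <= padic_norm z.
  by have /padic_norm_leP := lexx (padic_norm z); apply; exact: padic_norm_ge0.
by rewrite h /= h orbT.
Qed.

Lemma padic_norm_eq0 x : padic_norm x = 0 -> x = 0.
Proof.
move=> x0; apply/matrixP => i j; rewrite (ord1 i) mxE; apply: padic_abs_eq0.
apply/eqP; rewrite eq_le padic_abs_ge0 andbT.
by have /padic_norm_leP := lexx (padic_norm x); rewrite {2}x0; apply; rewrite x0.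
Qed.

Lemma padic_ball_sym g x y : padic_ball g x y -> padic_ball g y x.
Proof. by rewrite /padic_ball /= -padic_normN opprB. Qed.

Lemma padic_ball_trans g x y z : padic_ball g x y -> padic_ball g y z -> padic_ball g x z.
Proof.
rewrite /padic_ball /= => xy yz; rewrite -(subrKA y).
by rewrite (le_trans (padic_normD _ _)) // ge_max yz xy.
Qed.

Lemma padic_ball_eq g x y : padic_ball g x y -> padic_ball g x = padic_ball g y.
Proof.
move=> xy; apply/seteqP; split=> z; last exact: padic_ball_trans.
by apply: padic_ball_trans; exact: padic_ball_sym.
Qed.

Lemma padic_ball_le g g' x : (g <= g') -> padic_ball g x `<=` padic_ball g' x.
Proof. by move=> gg y /le_trans; apply; rewrite ler_eXz2l. Qed.

(** Balls of radius p ^ g are the classes of an equivalence relation; the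
    saturated sets are the unions of such balls. *)
Definition saturated g E := forall x y, E x -> padic_ball g x y -> E y.

Lemma saturated_ball g g' x : g <= g' -> saturated g (padic_ball g' x).
Proof. by move=> gg y z xy /(padic_ball_le gg); exact: padic_ball_trans. Qed.

Lemma saturated_le g g' E : g <= g' -> saturated g' E -> saturated g E.
Proof. by move=> gg sE x y Ex /(padic_ball_le gg); exact: sE. Qed.

Lemma saturatedD g E E' : saturated g E -> saturated g E' -> saturated g (E `\` E').
Proof.
move=> sE sE' x y [Ex nE'x] xy; split; first exact: (sE x).
by move=> E'y; exact: nE'x (sE' y x E'y (padic_ball_sym xy)).
Qed.

Lemma saturated_bigcup (I : Type) (D : set I) g (F : I -> set X) :
  (forall i, D i -> saturated g (F i)) -> saturated g (\bigcup_(i in D) F i).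
Proof. by move=> sF x y [i Di Fx] xy; exists i => //; exact: (sF i Di x). Qed.

Lemma locally_saturated_open E :
  (forall x, E x -> exists g, padic_ball g x `<=` E) -> open E.
Proof.
move=> sE; rewrite openE => x Ex; apply/nbhs_ballP.
have [g gE] := sE x Ex.
exists (p%:R ^ g); first exact: pX_gt0.
move=> y [_ xy]; apply: gE; apply/padic_norm_leP => // j; apply: ltW.
by rewrite mxE mxE -padic_absN opprB; exact: xy.
Qed.

Lemma saturated_measurable g E : saturated g E -> measurable E.
Proof.
move=> sE; apply: sub_sigma_algebra; apply: locally_saturated_open => x Ex.
by exists g => y; exact: sE.
Qed.

Lemma measurable_padic_ball g x : measurable (padic_ball g x).
Proof. by apply: saturated_measurable; exact: (@saturated_ball g). Qed.

(** A dense sequence, so that the space is a countable union of balls of any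
    given radius. *)
Definition padic_center (k : nat) : X :=
  \row_j padic_of_rat hp (odflt 0 (unpickle k : option 'rV[rat]_n) 0 j).

Lemma padic_center_dense g x : exists k, padic_ball g (padic_center k) x.
Proof.
have H j : {y : rat | padic_abs (x 0 j - padic_of_rat hp y) < p%:R ^ g}.
  by apply: cid; exact: padic_of_rat_dense.
exists (pickle (\row_j sval (H j))); apply/padic_norm_leP => // j.
rewrite mxE mxE /padic_center mxE pickleK /= mxE; apply: ltW; exact: (svalP (H j)).
Qed.

Lemma padic_ball_cover x : exists k : nat, padic_ball k%:Z 0 x.
Proof.
have [k xk] : exists k : nat, padic_norm x <= p%:R ^+ k.
  exists (Num.bound (padic_norm x)).
  apply: (le_trans (ltW (archi_boundP (padic_norm_ge0 x)))).
  by rewrite -natrX ler_nat ltnW // ltn_expl // prime_gt1.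
by exists k; rewrite /padic_ball /= subr0.
Qed.

(** Representatives of the p ^ n balls of radius p ^ (g - 1) that make up the
    ball of radius p ^ g around 0. *)
Definition padic_residue g (i : {ffun 'I_n -> 'I_p}) : X :=
  \row_j padic_of_rat hp ((i j)%:R * p%:R ^ (- g)).

Lemma padic_ball_residue g : padic_ball g (0 : X) =
  \bigcup_i padic_ball (g - 1) (padic_residue g i).
Proof.
have gg : g - 1 <= g by rewrite gerBl.
apply/seteqP; split=> [x|x [i _ xi]].
  move=> /(padic_norm_leP _ (pX_ge0 g)) H.
  have {}H j : {i : 'I_p | padic_abs (x 0 j - padic_of_rat hp (i%:R * p%:R ^ (- g)))
      <= p%:R ^ (g - 1)}.
    apply: cid; apply: padic_digit; have := H j; rewrite !mxE subr0; exact.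
  exists [ffun j => sval (H j)] => //.
  apply/padic_norm_leP => // j.
  rewrite mxE mxE mxE ffunE; exact: (svalP (H j)).
apply: (padic_ball_trans (y := padic_residue g i)); last exact: padic_ball_le xi.
apply/padic_norm_leP => // j; rewrite mxE mxE mxE mxE subr0.
rewrite padic_abs_of_rat rat_padic_absM // rat_padic_absX_p // opprK.
rewrite ler_piMl //; have [i0|i0] := posnP (i j).
  by rewrite i0 rat_padic_abs0.
by rewrite rat_padic_abs_digit.
Qed.

Lemma padic_ball_residue_triv g :
  trivIset setT (fun i => padic_ball (g - 1) (padic_residue g i)).
Proof.
move=> i i' _ _ [x [xi xi']]; apply/ffunP => j.
have /padic_ball_sym := padic_ball_trans xi (padic_ball_sym xi').
move=> /(padic_norm_leP _ (pX_ge0 _)) /(_ j).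
rewrite !mxE; exact: padic_digit_uniq.
Qed.

End PadicGeometry.

(** * Haar measure of balls *)

Section BallVolume.
Context (R : realType) (p : nat) (hp : prime p) (n : nat).
Implicit Types (g : int) (a : R).
Local Open Scope ereal_scope.
Local Notation rho g := (p%:R ^ g : R)%R.
Local Notation vol g := (rho g ^+ n)%R.

Lemma rho_gt0 g : (0 < rho g)%R.
Proof. by rewrite exprz_gt0 // ltr0n prime_gt0. Qed.

Lemma rho_le g g' : (g <= g')%R -> (rho g <= rho g')%R.
Proof. by move=> gg; rewrite ler_eXz2l // ltr1n prime_gt1. Qed.

Lemma vol_gt0 g : (0 < vol g)%R.
Proof. by rewrite exprn_gt0 // rho_gt0. Qed.

Lemma vol_le g g' : (g <= g')%R -> (vol g <= vol g')%R.
Proof.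
by move=> /rho_le gg; rewrite lerXn2r // nnegrE ltW // rho_gt0.
Qed.

Lemma vol_powR_anti g g' (a : R) : (g <= g')%R -> (a <= 0)%R ->
  (vol g' `^ a <= vol g `^ a)%R.
Proof.
move=> gg a0; have [v v'] := (vol_gt0 g, vol_gt0 g').
have aE w : (w `^ a = (w `^ (- a))^-1)%R by rewrite -powRN opprK.
rewrite !aE lef_pV2 ?posrE ?powR_gt0 //.
by apply: ge0_ler_powR; rewrite ?oppr_ge0 ?nnegrE ?(ltW v) ?(ltW v') // vol_le.
Qed.

Hypothesis hn : (1 <= n)%N.

Lemma vol_powR g a : (vol g `^ (a / n%:R) = rho g `^ a)%R.
Proof.
have n0 : (n%:R != 0 :> R)%R by rewrite pnatr_eq0 -lt0n.
rewrite -powR_mulrn; last exact/ltW/rho_gt0.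
by rewrite -powRrM mulrC divfK.
Qed.

End BallVolume.

Section HaarMeasure.
Context (R : realType) (p : nat) (hp : prime p) (n : nat).
Local Notation X := (padic_space hp n).
Context (mu : {measure set X -> \bar R}) (hmu : normalized_haar mu).
Implicit Types (x y z : X) (g : int) (E : set X).
Local Open Scope ereal_scope.

Lemma padic_ball_translate g x : [set (x + y)%R | y in padic_ball g (0%R : X)] = padic_ball g x.
Proof.
apply/seteqP; split=> [_ [y + <-]|y xy].
  by rewrite /padic_ball /= subr0 addrAC subrr add0r.
by exists (y - x)%R; [move: xy; rewrite /padic_ball /= subr0 | rewrite addrC subrK].
Qed.

Lemma haar_ball_center g x : mu (padic_ball g x) = mu (padic_ball g 0%R).
Proof.
by rewrite -padic_ball_translate; apply: hmu.1; exact: measurable_padic_ball.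
Qed.

(** The p ^ n residue balls are translates of one another. *)
Lemma haar_ball_step g :
  mu (padic_ball g 0%R) = (p%:R ^+ n)%:E * mu (padic_ball (g - 1) 0%R).
Proof.
rewrite padic_ball_residue measure_fin_bigcup; last 3 first.
- exact: finite_finset.
- exact: padic_ball_residue_triv.
- by move=> i _; exact: measurable_padic_ball.
rewrite (eq_fsbigr (fun=> mu (padic_ball (g - 1) 0%R))); last first.
  by move=> i _; exact: haar_ball_center.
have -> : [set: {ffun 'I_n -> 'I_p}] = [set` enum {: {ffun 'I_n -> 'I_p}}].
  by apply/seteqP; split=> // i _; rewrite /= mem_enum.
rewrite -fsbig_seq ?enum_uniq // big_const_seq count_predT iter_addr addr0.
by rewrite -cardE card_ffun !card_ord -natrX mule_natl.
Qed.

Local Notation rho g := (p%:R ^ g : R)%R.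

Lemma haar_ball g x : mu (padic_ball g x) = (rho g ^+ n)%:E.
Proof.
rewrite haar_ball_center.
have p0 : (p%:R != 0 :> R)%R by rewrite pnatr_eq0 -lt0n prime_gt0.
elim/ssrint.int_rect: g => [|k IH|k IH].
- by rewrite hmu.2 expr0z expr1n.
- rewrite haar_ball_step; have -> : (k.+1%:Z - 1 = k%:Z)%R by rewrite -addn1 PoszD addrK.
  by rewrite IH -EFinM -exprMn -exprSz.
- have := haar_ball_step (- k%:Z)%R.
  have -> : (- k%:Z - 1 = - k.+1%:Z)%R by rewrite -addn1 PoszD opprD.
  rewrite IH.
  have pn0 : (p%:R ^+ n != 0 :> R)%R by rewrite expf_neq0.
  move=> /(congr1 (fun t => ((p%:R ^+ n)^-1)%:E * t)).
  rewrite muleA -EFinM -EFinM mulVf // mul1e => <-; congr EFin.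
  by rewrite -exprVn -exprMn -exprN1 -expfzDr // -opprD addrC -PoszD addn1.
Qed.

(** The transfer principle behind all covering arguments below: a saturated set
    is a countable disjoint union of balls, so an inequality between integrals
    over each of them adds up. *)
Lemma ge0_le_integral_balls g E (f1 f2 : X -> \bar R) : saturated g E ->
  measurable_fun E f1 -> measurable_fun E f2 ->
  (forall x, E x -> 0 <= f1 x) -> (forall x, E x -> 0 <= f2 x) ->
  (forall x, E x -> \int[mu]_(y in padic_ball g x) f1 y <=
                    \int[mu]_(y in padic_ball g x) f2 y) ->
  \int[mu]_(y in E) f1 y <= \int[mu]_(y in E) f2 y.
Proof.
move=> sE mf1 mf2 f10 f20 H.
pose F k := E `&` padic_ball g (padic_center hp n k).
have sB x : saturated g (padic_ball g x) by exact: saturated_ball.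
have sF k : saturated g (F k).
  by move=> x y [Ex Bx] xy; split; [exact: (sE x)|exact: (sB _ x)].
have sD k : saturated g (seqDU F k).
  apply: saturatedD => //; rewrite -bigcup_mkord.
  exact: saturated_bigcup.
have mD k := saturated_measurable (sD k).
have EF : E = \bigcup_k seqDU F k.
  rewrite -seqDU_bigcup_eq; apply/seteqP; split=> [x Ex|x [k _ []]//].
  by have [k xk] := padic_center_dense g x; exists k.
rewrite EF !ge0_integral_bigcup -?EF //.
have DE k x : seqDU F k x -> E x by move=> Dx; rewrite EF; exists k.
apply: lee_nneseries => [k _ _|k _].
  by apply: integral_ge0 => x /DE; exact: f10.
have [->|/set0P[x Dx]] := eqVneq (seqDU F k) set0; first by rewrite !integral_set0.
suff -> : seqDU F k = padic_ball g x by apply: H; exact: DE Dx.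
apply/seteqP; split=> y; last exact: sD.
have DB z : seqDU F k z -> padic_ball g (padic_center hp n k) z by move=> [[]].
move=> /DB; apply: padic_ball_trans; exact/padic_ball_sym/DB.
Qed.

Local Notation chi g x := (\1_(padic_ball g x) : X -> R).

Lemma measurable_chi g x : measurable_fun setT (chi g x).
Proof. by apply: measurable_indic; exact: measurable_padic_ball. Qed.

Lemma Lnorm_chi (r : R) g x : (0 < r)%R ->
  'N[mu]_r%:E[EFin \o chi g x] = ((rho g ^+ n) `^ r^-1)%:E.
Proof.
move=> r0; rewrite unlock /=.
suff -> : \int[mu]_y (`|(\1_(padic_ball g x) y)%:E| `^ r) = mu (padic_ball g x).
  by rewrite haar_ball.
rewrite -[RHS](congr1 mu (setIT (padic_ball g x))) -integral_indic //; last first.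
  exact: measurable_padic_ball.
apply: eq_integral => y _; rewrite /= indicE.
by case: (_ \in _); rewrite ?normr1 ?powR1 ?normr0 ?powR0 // gt_eqF.
Qed.

End HaarMeasure.

(** * The maximal function: measurability and weak type *)

Section NonnegativeIntegral.
Context d (T : measurableType d) (R : realType) (mu : {measure set T -> \bar R}).
Local Open Scope ereal_scope.

(** Monotonicity for arbitrary nonnegative functions, the integral being a
    supremum over simple functions below the integrand. *)
Lemma le_integral_nonneg (D : set T) (f1 f2 : T -> \bar R) :
  (forall x, D x -> 0 <= f1 x) -> (forall x, D x -> f1 x <= f2 x) ->
  \int[mu]_(x in D) f1 x <= \int[mu]_(x in D) f2 x.
Proof.
move=> f10 f12; have f20 x : D x -> 0 <= f2 x.
  by move=> Dx; apply: (le_trans (f10 x Dx)); exact: f12.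
rewrite !ge0_integralE //; apply: ereal_sup_le => _ [h hf <-]; exists h => //= x.
apply: le_trans (hf x) _; rewrite /patch; case: ifPn => // /set_mem; exact: f12.
Qed.

End NonnegativeIntegral.

Section MaximalFunction.
Context (R : realType) (p : nat) (hp : prime p) (n : nat).
Local Notation X := (padic_space hp n).
Context (mu : {measure set X -> \bar R}) (hmu : normalized_haar mu).
Implicit Types (x y z : X) (g : int) (E : set X) (f : X -> R) (a : R).
Local Open Scope ereal_scope.
Local Notation rho g := (p%:R ^ g : R)%R.

(** Such a supremum is lower semicontinuous. *)
Lemma measurable_sup_local (I : Type) (D : set I) (F : I -> X -> \bar R) :
  (forall i, D i -> exists g, forall x y, padic_ball g x y -> F i x = F i y) ->
  measurable_fun setT (fun x => ereal_sup [set F i x | i in D]).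
Proof.
move=> FE; apply: (measurability _ (ErealGenOInfty.measurableE R)).
move=> /= _ [_ [c ->] <-]; rewrite setTI preimage_itvoy.
apply: sub_sigma_algebra; apply: locally_saturated_open => x /=.
move=> /ereal_sup_gt[_ [i Di <-] cF].
have [g FiE] := FE i Di; exists g => y /FiE yE.
by apply: (lt_le_trans cF); rewrite yE; apply: ereal_sup_ubound; exists i.
Qed.

Definition frac_average a f g x : \bar R :=
  mu (padic_ball g x) `^ (-1 + a / n%:R) * \int[mu]_(y in padic_ball g x) `|(f y)%:E|.

Lemma frac_average_ball a f g x y :
  padic_ball g x y -> frac_average a f g x = frac_average a f g y.
Proof. by move=> xy; rewrite /frac_average (padic_ball_eq xy). Qed.

Lemma measurable_frac_maximal a f : measurable_fun setT (frac_maximal mu a f).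
Proof.
apply: (@measurable_sup_local _ _ (fun g x => frac_average a f g x)) => g _.
by exists g => x y; exact: frac_average_ball.
Qed.

Lemma frac_average_ge0 a f g x : 0 <= frac_average a f g x.
Proof. by rewrite mule_ge0 ?poweR_ge0 ?integral_ge0. Qed.

Lemma frac_average_le_maximal a f g x : frac_average a f g x <= frac_maximal mu a f x.
Proof. by apply: ereal_sup_ubound; exists g. Qed.

Lemma frac_maximal_ge0 a f x : 0 <= frac_maximal mu a f x.
Proof. exact: le_trans (frac_average_ge0 a f 0 x) (frac_average_le_maximal _ _ _ _). Qed.

Lemma frac_averageE a f g x : frac_average a f g x =
  ((rho g ^+ n) `^ (-1 + a / n%:R))%:E * \int[mu]_(y in padic_ball g x) `|(f y)%:E|.
Proof. by rewrite /frac_average haar_ball. Qed.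

Lemma average0E f g x : frac_average 0 f g x =
  ((rho g ^+ n)^-1)%:E * \int[mu]_(y in padic_ball g x) `|(f y)%:E|.
Proof.
by rewrite frac_averageE mul0r addr0 powR_inv1 // exprn_ge0 // ltW // rho_gt0.
Qed.

Definition large_part f (t : R) x : \bar R := (`|f x| * \1_[set y | t < `|f y|]%R x)%:E.

Lemma large_part_ge0 f t x : 0 <= large_part f t x.
Proof. by rewrite lee_fin mulr_ge0. Qed.

Lemma measurable_large_part f t : measurable_fun setT f ->
  measurable_fun setT (large_part f t).
Proof.
move=> mf; apply/measurable_EFinP; apply: measurable_funM.
  exact: measurableT_comp.
apply: measurable_indic; rewrite -[X in measurable X]setTI.
have mf' : measurable_fun setT (fun y => (`|f y|%R)%:E).
  by apply/measurable_EFinP; exact: measurableT_comp.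
exact: (emeasurable_fun_o_infty measurableT mf' t%:E).
Qed.

(** Values of f below t / 2 contribute at most half of an average that exceeds
    t. *)
Lemma weak_type_ball f (t : R) g x : measurable_fun setT f -> (0 < t)%R ->
  t%:E < frac_average 0 f g x ->
  \int[mu]_(y in padic_ball g x) (t / 2)%:E <=
  \int[mu]_(y in padic_ball g x) large_part f (t / 2) y.
Proof.
move=> mf t0.
have v0 : (0 < rho g ^+ n)%R by rewrite exprn_gt0 // rho_gt0.
have mB := measurable_padic_ball g x.
have t2 : (0 <= t / 2)%R by rewrite divr_ge0 // ltW.
rewrite average0E lte_pdivlMl // => /ltW H.
have mL : measurable_fun (padic_ball g x) (large_part f (t / 2)).
  by apply: measurable_funTS; exact: measurable_large_part.
have : \int[mu]_(y in padic_ball g x) `|(f y)%:E| <=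
       \int[mu]_(y in padic_ball g x) (large_part f (t / 2) y + (t / 2)%:E).
  apply: le_integral_nonneg => // y _; rewrite /large_part -EFinD lee_fin indicE.
  have [h|h] := ltP (t / 2)%R `|f y|%R; first by rewrite mem_set // mulr1 lerDl.
  by rewrite memNset ?mulr0 ?add0r //; apply/negP; rewrite -leNgt.
rewrite ge0_integralD //=; last by move=> y _; exact: large_part_ge0.
rewrite !integral_cst // haar_ball // => /(le_trans H).
move: (\int[mu]_(_ in _) _) => [s||]; rewrite ?leey //.
rewrite -!EFinM -EFinD !lee_fin => h.
rewrite -(lerD2r (t / 2 * rho g ^+ n)); apply: le_trans h.
by rewrite -mulrDl -splitr mulrC.
Qed.

(** The weak-type (1,1) inequality, with only the large part of f on the right.
    Points where an average over a ball of radius at most p ^ N exceeds t are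
    sorted by the largest such radius: this splits them into saturated sets on
    which [weak_type_ball] adds up, and N then tends to infinity. *)
Lemma maximal_weak_type f (t : R) : measurable_fun setT f -> (0 < t)%R ->
  (t / 2)%:E * mu [set x | t%:E < frac_maximal mu 0 f x] <=
  \int[mu]_x large_part f (t / 2) x.
Proof.
move=> mf t0.
have t2 : (0 <= t / 2)%R by rewrite divr_ge0 // ltW.
pose E g := [set x | t%:E < frac_average 0 f g x].
have sE g : saturated g (E g).
  by move=> x y + xy; rewrite /E /= (frac_average_ball _ _ xy).
pose G (N k : nat) := E (N%:Z - k%:Z)%R.
pose U N := \bigcup_k G N k.
have sD N k : saturated (N%:Z - k%:Z)%R (seqDU (G N) k).
  apply: saturatedD; first exact: sE.
  rewrite -bigcup_mkord; apply: saturated_bigcup => j /= jk.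
  by apply: saturated_le (sE _); rewrite lerB // lez_nat ltnW.
have mD N k := saturated_measurable (sD N k).
have mU N : measurable (U N).
  by rewrite /U seqDU_bigcup_eq; exact: bigcup_measurable.
have UE : [set x | t%:E < frac_maximal mu 0 f x] = \bigcup_N U N.
  apply/seteqP; split=> [x /= /ereal_sup_gt[_ [g _ <-] tg]|x [N _ [k _ tk]]].
    have gg : (g <= (absz g)%:Z)%R by rewrite abszE ler_norm.
    exists (absz g) => //; exists (absz ((absz g)%:Z - g)%R) => //.
    by rewrite /G [X in E (_ - X)%R]gez0_abs ?subr_ge0 // subKr.
  exact: lt_le_trans tk (frac_average_le_maximal _ _ _ _).
have mL := measurable_large_part (t / 2) mf.
have HU N : (t / 2)%:E * mu (U N) <= \int[mu]_x large_part f (t / 2) x.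
  apply: (@le_trans _ _ (\int[mu]_(x in U N) large_part f (t / 2) x)); last first.
    by apply: ge0_subset_integral => // x _; exact: large_part_ge0.
  have UI (h : X -> \bar R) : measurable_fun setT h -> (forall x, 0 <= h x) ->
      \int[mu]_(x in U N) h x = \sum_(k <oo) \int[mu]_(x in seqDU (G N) k) h x.
    move=> mh h0; rewrite /U seqDU_bigcup_eq ge0_integral_bigcup //.
    exact: measurable_funTS.
  rewrite -integral_cst // !UI //; last by move=> x; exact: large_part_ge0.
  apply: lee_nneseries => [k _ _|k _]; first exact: integral_ge0.
  apply: ge0_le_integral_balls (sD N k) _ _ _ _ _ => //.
  - exact: measurable_funTS.
  - by move=> x _; exact: large_part_ge0.
  - by move=> x [] /=; rewrite /G /E /= => tx _; exact: weak_type_ball.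
rewrite UE.
(* U N is the level set of the maximal function restricted to radii at most
   p ^ N, so it increases with N. *)
have ndU : nondecreasing_seq U.
  move=> N M NM; apply/subsetPset => x [k _ xk]; exists (k + (M - N))%N => //.
  move: xk; rewrite /G; congr (E _ x).
  by rewrite PoszD -subzn // opprD opprB addrA addrC subrKA.
have cU := nondecreasing_cvg_mu (mu := mu) mU (bigcup_measurable (fun k _ => mU k)) ndU.
have cU2 : ((t / 2)%:E * mu (U N)) @[N --> \oo] --> (t / 2)%:E * mu (\bigcup_N U N).
  by apply: cvgeZl cU.
rewrite -(cvg_lim _ cU2) //; apply: lime_le; first exact: cvgP cU2.
exact: nearW.
Qed.

End MaximalFunction.

(** * Sums over dyadic levels *)

Section DyadicLevels.
Context (R : realType) (r : R) (r1 : 1 < r).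
Local Open Scope ereal_scope.

(** The levels 2 ^ (k - N), for k a natural number; N is the depth below which
    levels are cut off. *)
Definition dyadic (N k : nat) : R := (2 ^+ k / 2 ^+ N)%R.

Lemma dyadic_gt0 N k : (0 < dyadic N k)%R.
Proof. by rewrite divr_gt0 // exprn_gt0. Qed.

Lemma dyadicS N k : dyadic N k.+1 = (2 * dyadic N k)%R.
Proof. by rewrite /dyadic exprS mulrA. Qed.

Lemma dyadic_unbounded N (s : R) : exists k, (s <= dyadic N k)%R.
Proof.
exists (Num.bound (s * 2 ^+ N)); rewrite ler_pdivlMr ?exprn_gt0 //.
exact/ltW/upper_nthrootP.
Qed.

Lemma dyadic_level N (s : R) : (dyadic N 0 < s)%R ->
  exists k, (dyadic N k < s <= 2 * dyadic N k)%R.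
Proof.
move=> s0; have [m] := ex_minnP (dyadic_unbounded N s).
case: m => [|k]; first by rewrite leNgt s0.
move=> sk kmin; exists k; rewrite -dyadicS sk andbT ltNge.
by apply/negP => /kmin; rewrite ltnn.
Qed.

(** One term already suffices: the one of the largest level below w, or of
    arbitrarily large levels when w is infinite. *)
Lemma powR_le_dyadic_series N (w : \bar R) : (dyadic N 0)%:E < w ->
  w `^ r <= \sum_(k <oo) ((2 * dyadic N k) `^ r * ((dyadic N k)%:E < w)%E%:R)%:E.
Proof.
move=> w0; pose u k : \bar R := ((2 * dyadic N k) `^ r * ((dyadic N k)%:E < w)%E%:R)%:E; rewrite -/u.
have u0 k : 0 <= u k by rewrite lee_fin mulr_ge0 // powR_ge0.
have uS k : u k <= \sum_(i <oo) u i.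
  apply: le_trans (nneseries_lim_ge k.+1 _) => //.
  by rewrite big_nat_recr //= leeDr // sume_ge0.
have r0 : (0 <= r)%R by rewrite ltW // (lt_trans ltr01).
case: w w0 @u u0 uS => [s||] //=; rewrite ?lte_fin => s0 u0 uS.
  have [k /andP[ks sk]] := dyadic_level s0.
  apply: le_trans (uS k); rewrite lte_fin ks mulr1 lee_fin.
  have d0 := ltW (dyadic_gt0 N k).
  apply: ge0_ler_powR => //; rewrite nnegrE ?mulr_ge0 //.
  exact: le_trans d0 (ltW ks).
rewrite gt_eqF ?(lt_trans ltr01) // leye_eq; apply/eqP/eqyP => A A0.
have [k Ak] := dyadic_unbounded N (Num.max A 1%R).
apply: le_trans (uS k); rewrite ltry mulr1 lee_fin.
move: Ak; rewrite ge_max => /andP[Ak k1].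
have k2 : (dyadic N k <= 2 * dyadic N k)%R by rewrite ler_peMl ?ler1n // ltW // dyadic_gt0.
apply: (le_trans (le_trans Ak k2)); apply: le1r_powR; last exact: ltW.
exact: le_trans k2.
Qed.

Let s : R := (2 `^ (r - 1))%R.

Let s1 : (1 < s)%R.
Proof.
have : (1 `^ (r - 1) < 2 `^ (r - 1) :> R)%R.
  by apply: gt0_ltr_powR; rewrite ?subr_gt0 ?nnegrE ?ltr1n.
by rewrite powR1.
Qed.

Let level N k : R := (dyadic N k `^ (r - 1))%R.

Let levelS N k : level N k.+1 = (s * level N k)%R.
Proof. by rewrite /level dyadicS powRM // ltW // dyadic_gt0. Qed.

Let sum_level N m : (\sum_(0 <= k < m.+1) level N k <= s / (s - 1) * level N m)%R.
Proof.
have s10 : (0 < s - 1)%R by rewrite subr_gt0.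
elim: m => [|m IH].
  rewrite big_nat1 ler_peMl ?powR_ge0 // ler_pdivlMr // mul1r.
  by rewrite lerBlDr lerDl.
rewrite big_nat_recr //=; apply: le_trans (lerD IH (lexx _)) _.
have -> : (s / (s - 1) * level N m = (s - 1)^-1 * level N m.+1)%R.
  by rewrite levelS mulrAC mulrC [(s * _)%R]mulrC.
by rewrite le_eqVlt; apply/orP; left; apply/eqP; field; rewrite gt_eqF.
Qed.

(** Three factors: 2 ^ r from rounding up to the next level, 2 from the weak-type
    inequality, and s / (s - 1) * s for the geometric sum over the levels below
    2 t, which is at most s / (s - 1) times its last term, itself at most
    (2 t) ^ (r - 1) = s t ^ (r - 1). *)
Definition strong_type_constant : R := (2 `^ r * 2 * (s / (s - 1) * s))%R.

Lemma strong_type_constant_ge0 : (0 <= strong_type_constant)%R.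
Proof.
have s0 : (0 <= s)%R := powR_ge0 _ _.
by rewrite !mulr_ge0 ?powR_ge0 // invr_ge0 subr_ge0 ltW.
Qed.

(** The levels below 2 t form a geometric progression of ratio s > 1 once raised
    to the power r - 1 > 0, so their sum is comparable to the last one; the bound
    does not depend on the depth N. *)
Lemma dyadic_series_le_powR N (t : R) : (0 <= t)%R ->
  \sum_(k <oo) ((2 * dyadic N k) `^ r * (2 / dyadic N k) *
                (t * (dyadic N k / 2 < t)%R%:R))%:E <= (strong_type_constant * t `^ r)%:E.
Proof.
move=> t0; apply: lime_le.
  apply: is_cvg_nneseries => k _ _; rewrite lee_fin.
  by rewrite !mulr_ge0 ?powR_ge0 ?invr_ge0 ?(ltW (dyadic_gt0 _ _)).
apply: nearW => m; rewrite sumEFin lee_fin.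
have s10 : (0 < s - 1)%R by rewrite subr_gt0.
have K0 : (0 <= s / (s - 1))%R by rewrite divr_ge0 ?powR_ge0 // ltW.
have H : (\sum_(0 <= k < m) level N k * (dyadic N k / 2 < t)%R%:R <=
          s / (s - 1) * (2 * t) `^ (r - 1))%R.
  elim: m => [|m IH]; first by rewrite big_nil mulr_ge0 ?powR_ge0.
  have [h|h] := ltP (dyadic N m / 2)%R t; last first.
    by rewrite big_nat_recr //= ltNge h mulr0 addr0.
  apply: (@le_trans _ _ (\sum_(0 <= k < m.+1) level N k)%R).
    apply: ler_sum => k _; rewrite -[leRHS]mulr1 ler_wpM2l ?powR_ge0 //.
    by case: (_ < _)%R.
  apply: le_trans (sum_level N m) _; rewrite ler_wpM2l //.
  have d0 := ltW (dyadic_gt0 N m).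
  apply: ge0_ler_powR; rewrite ?nnegrE ?subr_ge0 ?mulr_ge0 //; first exact: ltW.
  by move: h; rewrite ltr_pdivrMr // mulrC => /ltW.
rewrite (eq_bigr (fun k => 2 `^ r * 2 * t * (level N k * (dyadic N k / 2 < t)%R%:R)))%R.
  rewrite -mulr_sumr; apply: (le_trans (ler_wpM2l _ H)).
    by rewrite !mulr_ge0 ?powR_ge0.
  rewrite powRM // /strong_type_constant -/s -(mulr_powRB1 t0 (lt_trans ltr01 r1)).
  by rewrite le_eqVlt; apply/orP; left; apply/eqP; ring.
move=> k _; have d0 := dyadic_gt0 N k.
rewrite powRM ?ltW // /level -(mulr_powRB1 (ltW d0) (lt_trans ltr01 r1)).
by field; rewrite gt_eqF.
Qed.

End DyadicLevels.

(** * The maximal function: strong type *)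

Section StrongType.
Context (R : realType) (p : nat) (hp : prime p) (n : nat).
Local Notation X := (padic_space hp n).
Context (mu : {measure set X -> \bar R}) (hmu : normalized_haar mu).
Implicit Types (x y z : X) (g : int) (E : set X) (f : X -> R) (a : R).
Local Open Scope ereal_scope.
Local Notation rho g := (p%:R ^ g : R)%R.
Local Notation M f := (frac_maximal mu 0 f).

(** Apply the weak-type inequality at each dyadic level, and exchange the sum
    over the levels with the integral of the large parts of f. *)
Lemma maximal_strong_type_level (r : R) f N : (1 < r)%R -> measurable_fun setT f ->
  \int[mu]_(x in [set x | (dyadic R N 0)%:E < M f x]) (M f x `^ r) <=
  (strong_type_constant r)%:E * \int[mu]_x (`|f x| `^ r)%:E.
Proof.
move=> r1 mf; have C0 := strong_type_constant_ge0 r1.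
pose tau k := dyadic R N k.
have t0 k : (0 < tau k)%R := dyadic_gt0 R N k.
have mM := measurable_frac_maximal mu 0 f.
pose A k : set X := [set x | (tau k)%:E < M f x].
have mA k : measurable (A k).
  by have := emeasurable_fun_o_infty measurableT mM (tau k)%:E; rewrite setTI.
pose c k : R := ((2 * tau k) `^ r)%R.
have c0 k : (0 <= c k)%R := powR_ge0 _ _.
pose L k x := ((c k * (2 / tau k))%:E * large_part f (tau k / 2) x).
have L0 k x : 0 <= L k x.
  by rewrite mule_ge0 ?large_part_ge0 // lee_fin mulr_ge0 ?divr_ge0 // ltW.
have mL k : measurable_fun setT (L k).
  by apply: measurable_funeM; exact: measurable_large_part.
apply: (@le_trans _ _ (\int[mu]_x \sum_(k <oo) ((c k)%:E * (\1_(A k) x)%:E))).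
  rewrite integral_mkcond; apply: le_integral_nonneg => x _.
    by apply: erestrict_ge0 => y _; exact: poweR_ge0.
  rewrite /patch; case: ifPn => [/set_mem /= Sx|_]; last first.
    by apply: nneseries_ge0 => k _ _; rewrite mule_ge0 // lee_fin.
  apply: le_trans (powR_le_dyadic_series r1 Sx) _.
  apply: lee_nneseries => [k _ _|k _]; first by rewrite lee_fin mulr_ge0 ?powR_ge0.
  rewrite -EFinM lee_fin /c indicE; apply: ler_wpM2l; first exact: powR_ge0.
  by case: (boolP (_ < _)) => // h; rewrite mem_set.
apply: (@le_trans _ _ (\int[mu]_x \sum_(k <oo) L k x)); last first.
  apply: (@le_trans _ _ (\int[mu]_x ((strong_type_constant r)%:E * (`|f x| `^ r)%:E))).
    apply: le_integral_nonneg => x _; first by apply: nneseries_ge0 => k _ _; exact: L0.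
    rewrite -EFinM.
    apply: le_trans (dyadic_series_le_powR r1 N (normr_ge0 (f x))).
    apply: lee_nneseries => [k _ _|k _]; first exact: L0.
    rewrite /L /large_part -EFinM lee_fin indicE; apply: ler_wpM2l.
      by rewrite mulr_ge0 ?divr_ge0 // ltW.
    apply: ler_wpM2l => //; case: (boolP (_ \in _)) => // /set_mem /= h.
    by rewrite /tau in h; rewrite h.
  rewrite ge0_integralZl_EFin //.
  apply/measurable_EFinP; apply: (measurableT_comp (measurable_powR r)).
  exact: measurableT_comp.
rewrite !integral_nneseries //; first last.
- by move=> k x _; rewrite mule_ge0 // lee_fin.
- move=> k; apply: measurable_funeM; apply/measurable_EFinP.
  exact: measurable_indic.
apply: lee_nneseries => [k _ _|k _].
  by apply: integral_ge0 => x _; rewrite mule_ge0 // lee_fin.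
rewrite ge0_integralZl_EFin //; last 1 first.
  by apply/measurable_EFinP; exact: measurable_indic.
rewrite integral_indic // setIT.
rewrite ge0_integralZl_EFin //; last 3 first.
- by move=> x _; exact: large_part_ge0.
- exact: measurable_large_part.
- by rewrite mulr_ge0 ?divr_ge0 // ltW.
rewrite EFinM -muleA; apply: lee_wpmul2l; first by rewrite lee_fin.
rewrite -[leLHS](mul1e) -[X in X%:E * _](mulVf (x := tau k / 2)); last first.
  by rewrite gt_eqF // divr_gt0.
rewrite EFinM -muleA invf_div; apply: lee_wpmul2l.
  by rewrite lee_fin divr_ge0 // ltW.
exact: maximal_weak_type.
Qed.

(** The bound at depth N is uniform in N, and the sets where M f exceeds 2 ^ - N
    exhaust the support of M f. *)
Lemma maximal_strong_type (r : R) f : (1 < r)%R -> measurable_fun setT f ->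
  \int[mu]_x (M f x `^ r) <=
  (strong_type_constant r)%:E * \int[mu]_x (`|f x| `^ r)%:E.
Proof.
move=> r1 mf.
pose S N := [set x | (dyadic R N 0)%:E < M f x].
have mM := measurable_frac_maximal mu 0 f.
have mMr : measurable_fun setT (fun x => M f x `^ r).
  exact: (measurableT_comp (measurable_poweR r)).
have mS N : measurable (S N).
  by have := emeasurable_fun_o_infty measurableT mM (dyadic R N 0)%:E; rewrite setTI.
have ndS : nondecreasing_seq S.
  move=> N N' NN; apply/subsetPset => x /=; rewrite /S /=; apply: le_lt_trans.
  rewrite lee_fin /dyadic ler_wpM2l ?exprn_ge0 //.
  by rewrite lef_pV2 ?posrE ?exprn_gt0 // ler_eXn2l ?ltr1n.
have cS := ge0_nondecreasing_set_cvg_integral (mu := mu) ndS mS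
  (fun i => measurable_funTS mMr) (fun i x _ => poweR_ge0 _ _).
apply: (@le_trans _ _ (\int[mu]_(x in \bigcup_N S N) (M f x `^ r))).
  rewrite [leRHS]integral_mkcond; apply: le_integral_nonneg => x _.
    exact: poweR_ge0.
  rewrite /patch; case: ifPn => // /negP nS.
  suff -> : M f x = 0 by rewrite poweR0r // gt_eqF // (lt_trans ltr01).
  apply/eqP; rewrite eq_le frac_maximal_ge0 andbT leNgt; apply/negP => M0.
  apply: nS; apply: mem_set.
  suff [N hN] : exists N, (dyadic R N 0)%:E < M f x by exists N.
  case: (M f x) M0 => [s| |] //; last by exists 0%N; rewrite ltry.
  rewrite lte_fin => s0; exists (Num.bound s^-1).
  rewrite lte_fin /dyadic expr0 mul1r -[ltRHS]invrK ltf_pV2 ?posrE ?invr_gt0 ?exprn_gt0 //.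
  exact: upper_nthrootP.
rewrite -(cvg_lim _ cS) //; apply: lime_le; first exact: cvgP cS.
apply: nearW => N; exact: maximal_strong_type_level.
Qed.

End StrongType.

(** * Fractional integration *)

Section FractionalIntegration.
Context (R : realType) (p : nat) (hp : prime p) (n : nat) (hn : (1 <= n)%N).
Local Notation X := (padic_space hp n).
Context (mu : {measure set X -> \bar R}) (hmu : normalized_haar mu).
Implicit Types (x y z : X) (g : int) (E : set X) (f : X -> R) (a : R).
Local Open Scope ereal_scope.
Local Notation rho g := (p%:R ^ g : R)%R.
Local Notation vol g := (rho g ^+ n)%R.

Lemma LfunW (r : R) f : f \in Lfun mu r%:E ->
  measurable_fun setT f /\ 'N[mu]_r%:E[EFin \o f] < +oo.
Proof.
move=> fL; split; first by have := sub_Lfun_mfun fL; rewrite inE.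
by have := sub_Lfun_finLfun fL; rewrite inE.
Qed.

Lemma hoelder_ball (r : R) f g x : (1 < r)%R -> measurable_fun setT f ->
  \int[mu]_(y in padic_ball g x) `|(f y)%:E| <=
  'N[mu]_r%:E[EFin \o f] * (vol g `^ (1 - r^-1))%:E.
Proof.
move=> r1 mf; have r0 := lt_trans ltr01 r1.
have r'0 : (0 < 1 - r^-1)%R by rewrite subr_gt0 invf_lt1.
have mB := measurable_padic_ball g x.
have mI := @measurable_chi R p hp n g x.
have := hoelder mu mf mI r0 (q := (1 - r^-1)^-1).
rewrite invr_gt0 => /(_ r'0); rewrite invrK addrC subrK => /(_ erefl).
rewrite Lnorm1 Lnorm_chi ?invr_gt0 // invrK => H; apply: le_trans (le_trans _ H) _ => //.
rewrite [leLHS]integral_mkcond; apply: le_integral_nonneg => y _.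
  exact: erestrict_ge0.
rewrite /patch; case: ifPn => yB; last exact: abse_ge0.
by rewrite /= indicE yB mulr1.
Qed.

(** Hedberg's inequality: a fractional average is a geometric mean of the plain
    average, bounded by the maximal function, and of the average normalized by
    the volume to the power 1 / r, bounded by the norm through Hoelder. The
    relation between q, r and a makes the powers of the volume cancel. *)
Lemma hedberg (r q a : R) f x : (1 < r)%R -> (0 < q)%R -> (0 < a)%R ->
  (q^-1 = r^-1 - a / n%:R)%R -> f \in Lfun mu r%:E ->
  frac_maximal mu a f x <= frac_maximal mu 0 f x `^ (r / q) *
    (fine ('N[mu]_r%:E[EFin \o f]) `^ (1 - r / q))%:E.
Proof.
move=> r1 q0 a0 qE /LfunW[mf Nf]; have r0 := lt_trans ltr01 r1.
have n0 : (0 < n%:R :> R)%R by rewrite ltr0n.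
set N := fine _.
have NN : 0 <= 'N[mu]_r%:E[EFin \o f] by exact: Lnorm_ge0.
have NE : 'N[mu]_r%:E[EFin \o f] = N%:E by rewrite /N fineK // ge0_fin_numE.
have N0 : (0 <= N)%R by rewrite fine_ge0.
have th1 : (r / q < 1)%R.
  rewrite qE mulrBr divff ?gt_eqF // gtrBl; apply: mulr_gt0 => //.
  exact: divr_gt0.
have th0 : (0 < r / q)%R by rewrite divr_gt0.
apply: ge_ereal_sup => _ [g _ <-].
have v0 := vol_gt0 R hp n g.
have HI := hoelder_ball g x r1 mf; rewrite NE -EFinM in HI.
have I0 : 0 <= \int[mu]_(y in padic_ball g x) `|(f y)%:E| by exact: integral_ge0.
rewrite -/(frac_average mu a f g x) frac_averageE //.
have := frac_average_le_maximal mu 0 f g x; rewrite average0E //.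
case: (\int[mu]_(y in padic_ball g x) _) I0 HI => [I||] //.
rewrite -!EFinM !lee_fin => I0 HI AM.
apply: (@le_trans _ _ (((vol g)^-1 * I) `^ (r / q) * N `^ (1 - r / q))%:E); last first.
  rewrite EFinM; apply: lee_wpmul2r; first by rewrite lee_fin powR_ge0.
  rewrite -poweR_EFin; apply: gt0_ler_poweR => //; first exact: ltW.
    by rewrite in_itv /= leey andbT lee_fin mulr_ge0 // invr_ge0 ltW.
  by rewrite in_itv /= leey andbT frac_maximal_ge0.
rewrite lee_fin powRM ?invr_ge0 ?(ltW v0) //.
have -> : (I = I `^ (r / q) * I `^ (1 - r / q))%R.
  rewrite -powRD; first by rewrite addrC subrK powRr1.
  by rewrite addrC subrK oner_eq0.
have HI2 : (I `^ (1 - r / q) <= N `^ (1 - r / q) * vol g `^ ((1 - r^-1) * (1 - r / q)))%R.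
  rewrite powRrM -powRM ?powR_ge0 //; apply: ge0_ler_powR; rewrite ?nnegrE ?mulr_ge0 ?powR_ge0 //.
  by rewrite subr_ge0 ltW.
have HI3 : ((I `^ (r / q) * I `^ (1 - r / q)) `^ (r / q) = I `^ (r / q))%R.
  rewrite -powRD; first by rewrite addrC subrK powRr1.
  by rewrite addrC subrK oner_eq0.
rewrite HI3 mulrCA [leRHS]mulrAC [leRHS]mulrC; apply: ler_wpM2l; first exact: powR_ge0.
apply: (@le_trans _ _ (vol g `^ (-1 + a / n%:R) *
   (N `^ (1 - r / q) * vol g `^ ((1 - r^-1) * (1 - r / q)))))%R.
  by apply: ler_wpM2l => //; exact: powR_ge0.
rewrite mulrCA -powRD; last by rewrite (gt_eqF v0) implybT.
rewrite [leRHS]mulrC; apply: ler_wpM2l; first exact: powR_ge0.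
rewrite -(powR_inv1 (ltW v0)) -powRrM le_eqVlt; apply/orP; left; apply/eqP; congr (_ `^ _)%R.
have -> : (a / n%:R = r^-1 - q^-1)%R by rewrite qE opprB addrC subrK.
by field; rewrite !gt_eqF.
Qed.

(** The q-th power of Hedberg's bound is the r-th power of the maximal function
    times a power of the norm, to which the strong-type inequality applies. *)
Lemma frac_maximal_Lq_bound (r q a : R) f : (1 < r)%R -> (0 < q)%R -> (0 < a)%R ->
  (q^-1 = r^-1 - a / n%:R)%R -> f \in Lfun mu r%:E ->
  'N[mu]_q%:E[frac_maximal mu a f] <=
  (strong_type_constant r `^ q^-1)%:E * 'N[mu]_r%:E[EFin \o f].
Proof.
move=> r1 q0 a0 qE fL; have [mf Nf] := LfunW fL; have r0 := lt_trans ltr01 r1.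
have HH x := hedberg x r1 q0 a0 qE fL.
have NN : 0 <= 'N[mu]_r%:E[EFin \o f] by exact: Lnorm_ge0.
have NE : 'N[mu]_r%:E[EFin \o f] = (fine ('N[mu]_r%:E[EFin \o f]))%:E.
  by rewrite fineK // ge0_fin_numE.
move: HH NE; set N := fine _ => HH NE.
have N0 : (0 <= N)%R by rewrite fine_ge0.
have C0 := strong_type_constant_ge0 r1.
have Nr : \int[mu]_x (`|f x| `^ r)%:E = (N `^ r)%:E.
  have := @poweR_Lnorm _ _ _ mu (EFin \o f) r; rewrite gt_eqF // => /(_ isT).
  by rewrite NE => <-.
rewrite NE unlock /=.
have key : \int[mu]_x (`|frac_maximal mu a f x| `^ q) <=
    (strong_type_constant r * N `^ q)%:E.
  apply: (@le_trans _ _ (\int[mu]_x ((N `^ (q - r))%:E * (frac_maximal mu 0 f x `^ r)))).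
    apply: le_integral_nonneg => x _; first exact: poweR_ge0.
    rewrite gee0_abs ?frac_maximal_ge0 //.
    apply: (@le_trans _ _ ((frac_maximal mu 0 f x `^ (r / q) *
      (N `^ (1 - r / q))%:E) `^ q)).
      apply: gt0_ler_poweR => //; first exact: ltW.
        by rewrite in_itv /= leey andbT frac_maximal_ge0.
      rewrite in_itv /= leey andbT.
      by rewrite mule_ge0 ?poweR_ge0 // lee_fin powR_ge0.
    rewrite poweRM ?poweR_ge0 ?lee_fin ?powR_ge0 // -poweRrM divfK ?gt_eqF //.
    rewrite poweR_EFin -powRrM mulrBl mul1r divfK ?gt_eqF // muleC.
    exact: lexx.
  rewrite ge0_integralZl_EFin ?powR_ge0 //; last 2 first.
  - by move=> x _; exact: poweR_ge0.
  - apply: (measurableT_comp (measurable_poweR r)); exact: measurable_frac_maximal.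
  apply: (@le_trans _ _ ((N `^ (q - r))%:E * ((strong_type_constant r)%:E * (N `^ r)%:E))).
    apply: lee_wpmul2l; first by rewrite lee_fin powR_ge0.
    by rewrite -Nr; exact: maximal_strong_type.
  rewrite -!EFinM lee_fin mulrCA -powRD ?subrK //.
  by rewrite gt_eqF.
apply: (@le_trans _ _ ((strong_type_constant r * N `^ q)%:E `^ q^-1)).
  apply: gt0_ler_poweR => //; first by rewrite invr_ge0 ltW.
    by rewrite in_itv /= leey andbT; apply: integral_ge0 => x _; exact: poweR_ge0.
  by rewrite in_itv /= leey andbT lee_fin mulr_ge0 ?powR_ge0.
by rewrite poweR_EFin powRM ?powR_ge0 // -powRrM divff ?gt_eqF // powRr1.
Qed.

Lemma frac_maximal_ae_finite (r q a : R) f : (1 < r)%R -> (0 < q)%R -> (0 < a)%R ->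
  (q^-1 = r^-1 - a / n%:R)%R -> f \in Lfun mu r%:E ->
  {ae mu, forall x, frac_maximal mu a f x \is a fin_num}.
Proof.
move=> r1 q0 a0 qE fL; have [_ Nf] := LfunW fL.
have H := frac_maximal_Lq_bound r1 q0 a0 qE fL.
have Hoo : \int[mu]_x (`|frac_maximal mu a f x| `^ q) < +oo.
  rewrite -poweR_Lnorm ?gt_eqF //; apply: poweR_lty; apply: le_lt_trans H _.
  by rewrite lte_mul_pinfty // lee_fin powR_ge0.
have mM : measurable_fun setT (fun x => `|frac_maximal mu a f x| `^ q).
  apply: (measurableT_comp (measurable_poweR q)); apply: measurableT_comp => //.
  exact: measurable_frac_maximal.
have : mu.-integrable setT (fun x => `|frac_maximal mu a f x| `^ q).
  apply/integrableP; split => //; move: Hoo; congr (_ < _).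
  by apply: eq_integral => x _; rewrite [RHS]gee0_abs ?poweR_ge0.
move=> /(integrable_ae measurableT); apply: filterS => x /= /(_ I).
rewrite ge0_fin_numE ?poweR_ge0 // => h.
rewrite ge0_fin_numE ?frac_maximal_ge0 //.
by rewrite -[ltLHS]gee0_abs ?frac_maximal_ge0 // (lty_poweRy _ h) // gt_eqF.
Qed.

Lemma admissible_exponents_gt1 (alpha beta r q : R) : (0 < alpha + beta)%R ->
  admissible_exponents n alpha beta r q ->
  [/\ (1 < r)%R, (1 < q)%R & (q^-1 = r^-1 - (alpha + beta) / n%:R)%R].
Proof.
move=> ab0 [/andP[r1 rn] qE]; have r0 := lt_trans ltr01 r1.
have n0 : (0 < n%:R :> R)%R by rewrite ltr0n.
have q0 : (0 < q)%R.
  rewrite -invr_gt0 qE subr_gt0 -invf_div.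
  by rewrite ltf_pV2 ?posrE ?divr_gt0.
split=> //; apply: (lt_trans r1); rewrite -ltf_pV2 ?posrE // qE.
by rewrite gtrBl divr_gt0.
Qed.

Lemma admissible_exponents_exist (alpha beta : R) : (0 < alpha + beta)%R ->
  (alpha + beta < n%:R)%R -> exists r q, admissible_exponents n alpha beta r q.
Proof.
move=> ab0 abn; set e := (n%:R / (alpha + beta))%R.
have e1 : (1 < e)%R by rewrite ltr_pdivlMr // mul1r.
exists ((1 + e) / 2)%R, (((1 + e) / 2)^-1 - (alpha + beta) / n%:R)^-1%R.
split; last by rewrite invrK.
by rewrite -/e; apply/andP; split; lra.
Qed.

End FractionalIntegration.

(** * Hoelder symbols give bounded commutators *)

Section LipschitzToBounded.
Context (R : realType) (p : nat) (hp : prime p) (n : nat) (hn : (1 <= n)%N).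
Local Notation X := (padic_space hp n).
Context (mu : {measure set X -> \bar R}) (hmu : normalized_haar mu).
Implicit Types (x y z : X) (g : int) (E : set X) (f b : X -> R) (a alpha beta : R).
Local Open Scope ereal_scope.
Local Notation rho g := (p%:R ^ g : R)%R.

Lemma lipschitz_on_balls beta f : (0 <= beta)%R -> lipschitz_seminorm beta f < +oo ->
  exists2 L : R, (0 <= L)%R & forall g x y, padic_ball g x y ->
    (`|f x - f y| <= L * rho g `^ beta)%R.
Proof.
move=> beta0 fL; exists `|fine (lipschitz_seminorm beta f)|%R => // g x y xy.
have [->|neq] := eqVneq x y; first by rewrite subrr normr0 mulr_ge0 ?powR_ge0.
have N0 : (0 < padic_norm (x - y))%R.
  rewrite lt_neqAle padic_norm_ge0 andbT eq_sym.
  apply: contra_neq neq => /padic_norm_eq0 /eqP; rewrite subr_eq0 => /eqP; exact.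
set N : R := ratr (padic_norm (x - y)%R).
have {}N0 : (0 < N)%R by rewrite ltr0q.
have Nrho : (N <= rho g)%R.
  have <- : (ratr (p%:R ^ g) = rho g)%R by rewrite fmorphXz /= ratr_nat.
  by rewrite ler_rat; exact: padic_ball_sym xy.
have H : (`|f x - f y| / N `^ beta)%:E <= lipschitz_seminorm beta f.
  by apply: ereal_sup_ubound; exists (x, y).
have {}H : (`|f x - f y| <= fine (lipschitz_seminorm beta f) * N `^ beta)%R.
  rewrite -ler_pdivrMr ?powR_gt0 // -lee_fin fineK //.
  by rewrite fin_numE; apply/andP; split; [rewrite gt_eqF // (lt_le_trans _ H) // ltNyr|rewrite lt_eqF].
apply: (le_trans H); apply: ler_pM (ler_norm _) _; rewrite ?powR_ge0 //; last first.
  by apply: ge0_ler_powR => //; rewrite nnegrE ltW // rho_gt0.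
rewrite -(pmulr_lge0 _ (powR_gt0 beta N0)); exact: le_trans (normr_ge0 _) H.
Qed.

Lemma dist_le_of_add (u v w : \bar R) : u \is a fin_num -> 0 <= v -> 0 <= w ->
  v <= u + w -> u <= v + w -> `|u - v| <= w.
Proof.
case: u => [u| |] // _; case: w => [w| |] //; last by move=> *; rewrite leey.
case: v => [v| |] //; rewrite -?EFinD ?lee_fin // => v0 w0 h1 h2.
by rewrite ler_norml; apply/andP; split; lra.
Qed.

Lemma frac_average_shift alpha beta f g x :
  (rho g `^ beta)%:E * frac_average mu alpha f g x = frac_average mu (alpha + beta) f g x.
Proof.
rewrite !frac_averageE // muleA -EFinM; congr (_%:E * _).
have v0 := vol_gt0 R hp n g.
rewrite -(vol_powR hp hn) -powRD; last by rewrite (gt_eqF v0) implybT.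
by congr (_ `^ _)%R; rewrite addrC mulrDl addrA.
Qed.

(** Where b is almost everywhere nonnegative and Hoelder around x, replacing b(y)
    by b(x) in an average over a ball of radius p ^ g costs L p ^ (g beta) times
    the average, and the factor p ^ (g beta) turns the order alpha into
    alpha + beta. *)
Section Pointwise.
Context (alpha beta L : R) (L0 : (0 <= L)%R) (b f : X -> R) (x : X).
Hypotheses (mb : measurable_fun setT b) (mf : measurable_fun setT f).
Hypothesis bx0 : (0 <= b x)%R.
Hypothesis bL : {ae mu, forall y, (0 <= b y)%R /\
  forall g, padic_ball g x y -> (`|b x - b y| <= L * rho g `^ beta)%R}.

Let mef : measurable_fun setT (fun y => `|(f y)%:E|).
Proof. by apply: measurableT_comp => //; exact/measurable_EFinP. Qed.

Let mebf : measurable_fun setT (fun y => `|((b \* f)%R y)%:E|).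
Proof.
by apply: measurableT_comp => //; apply/measurable_EFinP; exact: measurable_funM.
Qed.

Let W g : R := (L * rho g `^ beta)%R.

Let W0 g : (0 <= W g)%R.
Proof. by rewrite mulr_ge0 ?powR_ge0. Qed.

Let ball_upper g : \int[mu]_(y in padic_ball g x) `|((b \* f)%R y)%:E| <=
  (b x + W g)%:E * \int[mu]_(y in padic_ball g x) `|(f y)%:E|.
Proof.
have mB := measurable_padic_ball g x.
have bW : (0 <= b x + W g)%R by rewrite addr_ge0.
rewrite -ge0_integralZl_EFin //; last exact: measurable_funTS.
apply: ae_ge0_le_integral => //.
- exact: measurable_funTS.
- by move=> y _; rewrite mule_ge0 // lee_fin.
- by apply: measurable_funeM; exact: measurable_funTS.
apply: filterS bL => y [by0 bW'] xy; have := bW' g xy.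
rewrite /= lee_fin normrM (ger0_norm by0) => H; apply: ler_wpM2r => //.
by move: H; rewrite ler_norml => /andP[]; rewrite /W; lra.
Qed.

Let ball_lower g : (b x)%:E * \int[mu]_(y in padic_ball g x) `|(f y)%:E| <=
  \int[mu]_(y in padic_ball g x) `|((b \* f)%R y)%:E| +
  (W g)%:E * \int[mu]_(y in padic_ball g x) `|(f y)%:E|.
Proof.
have mB := measurable_padic_ball g x.
rewrite -!ge0_integralZl_EFin //; try exact: measurable_funTS.
rewrite -ge0_integralD //.
- apply: ae_ge0_le_integral => //.
  + by move=> y _; rewrite mule_ge0 // lee_fin.
  + by apply: measurable_funeM; exact: measurable_funTS.
  + by move=> y _; rewrite adde_ge0 // mule_ge0 // lee_fin.
  + apply: emeasurable_funD; first exact: measurable_funTS.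
    by apply: measurable_funeM; exact: measurable_funTS.
  apply: filterS bL => y [by0 bW'] xy; have := bW' g xy.
  rewrite /= lee_fin normrM (ger0_norm by0) -mulrDl => H; apply: ler_wpM2r => //.
  by move: H; rewrite ler_norml => /andP[]; rewrite /W; lra.
- exact: measurable_funTS.
- by move=> y _; rewrite mule_ge0 // lee_fin.
- by apply: measurable_funeM; exact: measurable_funTS.
Qed.

Let wt g : R := ((rho g ^+ n) `^ (-1 + alpha / n%:R))%R.

Let wt0 g : 0 <= (wt g)%:E.
Proof. by rewrite lee_fin powR_ge0. Qed.

Let average_split g : (wt g)%:E * ((W g)%:E * \int[mu]_(y in padic_ball g x) `|(f y)%:E|) =
   L%:E * frac_average mu (alpha + beta) f g x.
Proof.
by rewrite -frac_average_shift frac_averageE // muleCA EFinM -!muleA.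
Qed.

Lemma frac_commutator_le : frac_maximal mu alpha f x \is a fin_num ->
  `|frac_commutator mu b alpha f x| <= L%:E * frac_maximal mu (alpha + beta) f x.
Proof.
move=> Mfin; rewrite /frac_commutator.
have LM0 a : 0 <= L%:E * frac_maximal mu a f x.
  by rewrite mule_ge0 ?frac_maximal_ge0 // lee_fin.
have Lav g : L%:E * frac_average mu (alpha + beta) f g x <=
    L%:E * frac_maximal mu (alpha + beta) f x.
  by apply: lee_wpmul2l; [rewrite lee_fin|exact: frac_average_le_maximal].
apply: dist_le_of_add; rewrite ?frac_maximal_ge0 ?fin_numM //.
- apply: ge_ereal_sup => _ [g _ <-].
  rewrite -/(frac_average mu alpha (b \* f)%R g x) frac_averageE //.
  apply: (le_trans (lee_wpmul2l (wt0 g) (ball_upper g))).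
  rewrite EFinD ge0_muleDl ?lee_fin // ge0_muleDr ?mule_ge0 ?integral_ge0 ?lee_fin //.
  rewrite average_split; apply: leeD => //.
  rewrite muleCA; apply: lee_wpmul2l; first by rewrite lee_fin.
  by rewrite -frac_averageE //; exact: frac_average_le_maximal.
- have [bx|bx] := eqVneq (b x) 0%R.
    by rewrite bx mul0e adde_ge0 ?frac_maximal_ge0.
  have {}bx : (0 < b x)%R by rewrite lt_neqAle eq_sym bx.
  rewrite -lee_pdivlMl //; apply: ge_ereal_sup => _ [g _ <-].
  rewrite lee_pdivlMl // -/(frac_average mu alpha f g x) frac_averageE // muleCA.
  apply: (le_trans (lee_wpmul2l (wt0 g) (ball_lower g))).
  rewrite ge0_muleDr ?mule_ge0 ?integral_ge0 ?lee_fin // average_split.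
  apply: leeD => //.
  by rewrite -frac_averageE //; exact: frac_average_le_maximal.
Qed.

End Pointwise.

Lemma lipschitz_commutator_bounded alpha beta (r q : R) b :
  (0 < alpha)%R -> (0 < beta)%R -> measurable_fun setT b ->
  lipschitz_space mu beta b -> {ae mu, forall x, (0 <= b x)%R} ->
  admissible_exponents n alpha beta r q ->
  bounded_Lfun mu r q (frac_commutator mu b alpha).
Proof.
move=> alpha0 beta0 mb [G [mG GL bG]] b0 Hrq.
have ab0 : (0 < alpha + beta)%R by rewrite addr_gt0.
have n0 : (0 < n%:R :> R)%R by rewrite ltr0n.
have [r1 q1 qE] := admissible_exponents_gt1 hn ab0 Hrq.
have q0 := lt_trans ltr01 q1.
(* The exponent q' is the one paired with r by alpha alone; it serves only to
   make the maximal function of order alpha finite almost everywhere. *)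
pose q' : R := (r^-1 - alpha / n%:R)^-1%R.
have q'E : (q'^-1 = r^-1 - alpha / n%:R)%R by rewrite invrK.
have q'0 : (0 < q')%R.
  rewrite -invr_gt0 q'E; have : (0 < q^-1)%R by rewrite invr_gt0.
  rewrite qE mulrDl; have : (0 < beta / n%:R)%R by rewrite divr_gt0.
  by lra.
have [L L0 HL] := lipschitz_on_balls (ltW beta0) GL.
exists (L * strong_type_constant r `^ q^-1)%R => f fL.
have [mf Nf] := LfunW fL.
have mT : measurable_fun setT (frac_commutator mu b alpha f).
  apply: emeasurable_funB; last exact: measurable_frac_maximal.
  apply: emeasurable_funM; first exact/measurable_EFinP.
  exact: measurable_frac_maximal.
split=> //.
have bound : {ae mu, forall x, setT x -> `|frac_commutator mu b alpha f x| `^ q <=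
    (L `^ q)%:E * (frac_maximal mu (alpha + beta) f x `^ q)}.
  have Mfin := frac_maximal_ae_finite hn hmu r1 q'0 alpha0 q'E fL.
  move: (bG) (b0) Mfin; apply: filterS3 => x /(_ I) bGx bx0 Mx _.
  rewrite -poweR_EFin -poweRM ?lee_fin ?frac_maximal_ge0 //.
  apply: gt0_ler_poweR; first exact: ltW.
  - by rewrite in_itv /= leey andbT.
  - by rewrite in_itv /= leey andbT mule_ge0 ?frac_maximal_ge0 // lee_fin.
  apply: frac_commutator_le => //.
  move: bG b0; apply: filterS2 => y /(_ I) bGy by0; split=> // g xy.
  by rewrite bGx bGy; exact: HL.
apply: (@le_trans _ _ (L%:E * 'N[mu]_q%:E[frac_maximal mu (alpha + beta) f])); last first.
  rewrite EFinM -muleA; apply: lee_wpmul2l; first by rewrite lee_fin.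
  exact: frac_maximal_Lq_bound.
rewrite unlock /=.
have mMq : measurable_fun setT (fun x => frac_maximal mu (alpha + beta) f x `^ q).
  by apply: (measurableT_comp (measurable_poweR q)); exact: measurable_frac_maximal.
have H : \int[mu]_x (`|frac_commutator mu b alpha f x| `^ q) <=
    (L `^ q)%:E * \int[mu]_x (`|frac_maximal mu (alpha + beta) f x| `^ q).
  rewrite -ge0_integralZl_EFin ?powR_ge0 //; last 2 first.
  - by move=> x _; exact: poweR_ge0.
  - by under eq_fun do rewrite gee0_abs ?frac_maximal_ge0 //.
  apply: ae_ge0_le_integral => //.
  - by move=> x _; exact: poweR_ge0.
  - by apply: (measurableT_comp (measurable_poweR q)); exact: measurableT_comp.
  - by move=> x _; rewrite mule_ge0 ?poweR_ge0 // lee_fin powR_ge0.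
  - by apply: measurable_funeM; under eq_fun do rewrite gee0_abs ?frac_maximal_ge0 //.
  by apply: filterS bound => x h _; rewrite (gee0_abs (frac_maximal_ge0 _ _ _ _)); exact: h.
apply: (@le_trans _ _ (((L `^ q)%:E *
    \int[mu]_x (`|frac_maximal mu (alpha + beta) f x| `^ q)) `^ q^-1)).
  apply: gt0_ler_poweR => //; first by rewrite invr_ge0 ltW.
    by rewrite in_itv /= leey andbT; apply: integral_ge0 => x _; exact: poweR_ge0.
  rewrite in_itv /= leey andbT mule_ge0 ?lee_fin ?powR_ge0 //.
  by apply: integral_ge0 => x _; exact: poweR_ge0.
rewrite poweRM ?lee_fin ?powR_ge0 //; last first.
  by apply: integral_ge0 => x _; exact: poweR_ge0.
by rewrite poweR_EFin -powRrM divff ?gt_eqF // powRr1.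
Qed.

End LipschitzToBounded.

(** * Bounded commutators have symbols of finite oscillation *)

Section BoundedToOscillation.
Context (R : realType) (p : nat) (hp : prime p) (n : nat) (hn : (1 <= n)%N).
Local Notation X := (padic_space hp n).
Context (mu : {measure set X -> \bar R}) (hmu : normalized_haar mu).
Implicit Types (x y z : X) (g : int) (f b : X -> R) (alpha beta : R).
Local Open Scope ereal_scope.
Local Notation rho g := (p%:R ^ g : R)%R.
Local Notation vol g := (rho g ^+ n)%R.
Local Notation chi g x := (\1_(padic_ball g x) : X -> R).

Lemma chi_Lfun (r : R) g x : (0 < r)%R -> chi g x \in Lfun mu r%:E.
Proof.
move=> r0; apply/andP; split; rewrite inE; first exact: measurable_chi.
by rewrite /finite_norm /= Lnorm_chi // ltry.
Qed.

Lemma integral_chi g x (b : X -> R) A :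
  \int[mu]_(y in A) `|((b \* chi g x)%R y)%:E| =
  \int[mu]_(y in A `&` padic_ball g x) `|(b y)%:E|.
Proof.
rewrite [LHS]integral_mkcond [RHS]integral_mkcond; apply: eq_integral => y _.
rewrite /patch in_setI /= indicE.
by case: (y \in A) => //=; case: (_ \in _); rewrite ?mulr1 // mulr0 normr0.
Qed.

Lemma integral_chi_sub g x g' y b : padic_ball g' y `<=` padic_ball g x ->
  \int[mu]_(z in padic_ball g' y) `|((b \* chi g x)%R z)%:E| =
  \int[mu]_(z in padic_ball g' y) `|(b z)%:E|.
Proof. by move=> /setIidPl sub; rewrite integral_chi sub. Qed.

Lemma padic_ball_sub g g' x y : padic_ball g x y -> (g' <= g)%R ->
  padic_ball g' y `<=` padic_ball g x.
Proof. by move=> xy gg; rewrite (padic_ball_eq xy); exact: padic_ball_le. Qed.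

(** Balls around y larger than B see no more mass of b 1_B than B itself, while
    their weight is smaller since alpha < n. *)
Lemma frac_maximal_chi alpha g x b y : (alpha < n%:R)%R -> padic_ball g x y ->
  frac_maximal mu alpha (b \* chi g x)%R y = frac_maximal_on mu (padic_ball g x) alpha b y.
Proof.
move=> an xy; have n0 : (0 < n%:R :> R)%R by rewrite ltr0n.
have a0 : (-1 + alpha / n%:R <= 0)%R by rewrite addrC subr_le0 ler_pdivrMr // mul1r ltW.
apply/eqP; rewrite eq_le; apply/andP; split; apply: ge_ereal_sup => _ [g' h <-].
  have [gg|gg] := leP g' g.
    rewrite integral_chi_sub; last exact: padic_ball_sub.
    by apply: ereal_sup_ubound; exists g'; [exact: padic_ball_sub | by []].
  apply: (@le_trans _ _ (mu (padic_ball g y) `^ (-1 + alpha / n%:R) *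
      \int[mu]_(z in padic_ball g y) `|(b z)%:E|)); last first.
    by apply: ereal_sup_ubound; exists g; [exact: padic_ball_sub | by []].
  rewrite !haar_ball // !poweR_EFin integral_chi.
  rewrite (padic_ball_eq xy) setIC (setIidl _); last exact/padic_ball_le/ltW.
  apply: lee_wpmul2r; first exact: integral_ge0.
  by rewrite lee_fin; apply: vol_powR_anti => //; exact: ltW.
apply: ereal_sup_ubound; exists g' => //.
by rewrite integral_chi_sub.
Qed.

(** With [frac_maximal_chi], this computes the maximal function of 1_B on B. *)
Lemma frac_maximal_on_cst1 alpha g x y : (0 < alpha)%R -> padic_ball g x y ->
  frac_maximal_on mu (padic_ball g x) alpha (cst 1%R) y = (vol g `^ (alpha / n%:R))%:E.
Proof.
move=> a0 xy; have n0 : (0 < n%:R :> R)%R by rewrite ltr0n.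
have E g' : mu (padic_ball g' y) `^ (-1 + alpha / n%:R) *
    \int[mu]_(z in padic_ball g' y) `|((cst 1 : X -> R) z)%:E| =
    (vol g' `^ (alpha / n%:R))%:E.
  have v0 := vol_gt0 R hp n g'.
  under eq_integral do rewrite /= normr1.
  rewrite integral_cst ?mul1e; last exact: measurable_padic_ball.
  rewrite haar_ball // poweR_EFin -EFinM; congr _%:E.
  rewrite -{2}(powRr1 (ltW v0)) -powRD; last by rewrite (gt_eqF v0) implybT.
  by rewrite addrAC addNr add0r.
apply/eqP; rewrite eq_le; apply/andP; split; last first.
  by apply: ereal_sup_ubound; exists g; [exact: padic_ball_sub | by []].
apply: ge_ereal_sup => _ [g' sub <-]; rewrite E lee_fin.
apply: ge0_ler_powR; rewrite ?nnegrE ?(ltW (vol_gt0 _ _ _ _)) //.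
  by rewrite divr_ge0 // ltW.
have : mu (padic_ball g' y) <= mu (padic_ball g x).
  by apply: le_measure; rewrite ?inE //; exact: measurable_padic_ball.
by rewrite !haar_ball // lee_fin.
Qed.

(** Test the commutator on 1_B: on B it is the integrand of the oscillation times
    the volume to the power alpha / n, and the remaining powers of the volume
    cancel by the relation between q and r. *)
Lemma bounded_commutator_oscillation alpha beta (r q : R) b :
  (0 < alpha)%R -> (alpha < n%:R)%R -> (1 < r)%R -> (0 < q)%R ->
  (q^-1 = r^-1 - (alpha + beta) / n%:R)%R ->
  bounded_Lfun mu r q (frac_commutator mu b alpha) ->
  frac_oscillation mu b alpha beta q < +oo.
Proof.
move=> alpha0 an r1 q0 qE [C HC]; have r0 := lt_trans ltr01 r1.
apply: (@le_lt_trans _ _ C%:E); last exact: ltry.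
apply: ge_ereal_sup => _ [[g x] _ <-]; cbv zeta; rewrite [(g, x).1]/= [(g, x).2]/=.
set B := padic_ball g x.
have mB : measurable B by exact: measurable_padic_ball.
have [mT HT] := HC _ (chi_Lfun g x r0).
set T := frac_commutator mu b alpha (chi g x) in mT HT.
have v0 := vol_gt0 R hp n g.
set v := vol g in v0.
pose c : R := (v `^ (- alpha / n%:R))%R.
have c0 : (0 < c)%R by exact: powR_gt0.
have TE y : B y ->
    `|(b y)%:E - mu B `^ (- alpha / n%:R) * frac_maximal_on mu B alpha b y| = c%:E * `|T y|.
  move=> By; rewrite haar_ball // -/v poweR_EFin -/c.
  rewrite -(frac_maximal_chi _ an By) /T /frac_commutator.
  have -> : frac_maximal mu alpha (chi g x) y = (v `^ (alpha / n%:R))%:E.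
    rewrite -(frac_maximal_on_cst1 alpha0 By) -(frac_maximal_chi _ an By).
    by congr frac_maximal; apply/funext => z /=; rewrite mul1r.
  have -> : c%:E = `|c%:E| by rewrite gee0_abs // lee_fin ltW.
  rewrite -abseM [`|c%:E|]gee0_abs ?lee_fin ?(ltW c0) // muleBr //.
  rewrite muleCA -!EFinM.
  rewrite /c mulNr powRN mulVf ?mulr1 // gt_eqF // powR_gt0 //.
have IT : \int[mu]_(y in B) (`|(b y)%:E - mu B `^ (- alpha / n%:R) *
      frac_maximal_on mu B alpha b y| `^ q) <= (c `^ q)%:E * \int[mu]_y (`|T y| `^ q).
  have mTq : measurable_fun setT (fun y => `|T y| `^ q).
    by apply: (measurableT_comp (measurable_poweR q)); exact: measurableT_comp.
  rewrite [leLHS](eq_integral (fun y => (c `^ q)%:E * (`|T y| `^ q))); last first.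
    by move=> y /set_mem By; rewrite TE // poweRM ?abse_ge0 // lee_fin ltW.
  rewrite ge0_integralZl_EFin ?powR_ge0 //; last 2 first.
  - by move=> y _; exact: poweR_ge0.
  - exact: measurable_funTS.
  apply: lee_wpmul2l; first by rewrite lee_fin powR_ge0.
  by apply: ge0_subset_integral => // y _; exact: poweR_ge0.
rewrite Lnorm_chi // -/v in HT.
have J0 : 0 <= \int[mu]_y (`|T y| `^ q) by apply: integral_ge0 => y _; exact: poweR_ge0.
have : 0 <= \int[mu]_(y in B) (`|(b y)%:E - mu B `^ (- alpha / n%:R) *
      frac_maximal_on mu B alpha b y| `^ q).
  by apply: integral_ge0 => y _; exact: poweR_ge0.
move: IT; set I := integral mu B _ => IT I0.
have -> : mu B = v%:E by rewrite /B haar_ball.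
rewrite poweR_EFin !inver !gt_eqF ?powR_gt0 //.
apply: (@le_trans _ _ ((v `^ (beta / n%:R))^-1%:E *
  (v^-1%:E * ((c `^ q)%:E * \int[mu]_y (`|T y| `^ q))) `^ q^-1)).
  apply: lee_wpmul2l; first by rewrite lee_fin invr_ge0 powR_ge0.
  apply: gt0_ler_poweR; first by rewrite invr_ge0 ltW.
  - by rewrite in_itv /= leey andbT mule_ge0 ?lee_fin ?invr_ge0 ?(ltW v0).
  - by rewrite in_itv /= leey andbT !mule_ge0 ?lee_fin ?invr_ge0 ?(ltW v0) ?powR_ge0.
  - by apply: lee_wpmul2l => //; rewrite lee_fin invr_ge0 ltW.
rewrite muleA -EFinM poweRM ?lee_fin ?mulr_ge0 ?invr_ge0 ?powR_ge0 ?(ltW v0) //.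
have -> : (\int[mu]_y (`|T y| `^ q)) `^ q^-1 = 'N[mu]_q%:E[T] by rewrite unlock.
rewrite poweR_EFin powRM ?invr_ge0 ?powR_ge0 ?(ltW v0) // -powRrM divff ?gt_eqF //.
rewrite (powRr1 (ltW c0)) muleA -EFinM.
set k := (_ * _)%R.
have k0 : 0 <= k%:E.
  by rewrite lee_fin !mulr_ge0 ?invr_ge0 ?powR_ge0.
apply: (le_trans (lee_wpmul2l k0 HT)); rewrite -!EFinM lee_fin mulrCA.
suff -> : (k * v `^ r^-1 = 1)%R by rewrite mulr1.
rewrite /k /c -(powR_inv1 (ltW v0)) -powRrM -powRN -!powRD ?(gt_eqF v0) ?implybT //.
rewrite (_ : (_ + _ = 0)%R) ?powRr0 //.
by rewrite qE; ring.
Qed.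

End BoundedToOscillation.

(** * Symbols of finite oscillation are Hoelder and nonnegative *)

Lemma int_homo (R : realType) (u : int -> R) : (forall g, u g <= u (g + 1)) ->
  forall g g', g <= g' -> u g <= u g'.
Proof.
move=> uS g g' gg; have [k ->] : exists k : nat, g' = g + k%:Z.
  by exists `|g' - g|%N; rewrite gez0_abs ?subr_ge0 // subrKC.
elim: k => [|k IH]; first by rewrite addr0.
by rewrite -addn1 PoszD addrA; apply: le_trans IH (uS _).
Qed.

(** Campanato's characterization of Hoelder functions: if on each ball b deviates
    in mean by O(p ^ (g beta)) from a constant m, then b is Hoelder. The constants
    of concentric balls of radii p ^ g and p ^ (g + 1) differ by O(p ^ (g beta)),
    hence converge geometrically as g tends to minus infinity, and their limit is
    the continuous representative of b. *)
Section Campanato.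
Context (R : realType) (p : nat) (hp : prime p) (n : nat).
Local Notation X := (padic_space hp n).
Context (mu : {measure set X -> \bar R}) (hmu : normalized_haar mu).
Local Notation rho g := (p%:R ^ g : R)%R.
Local Notation vol g := (rho g ^+ n)%R.
Context (beta : R) (beta0 : 0 < beta) (b : X -> R) (mb : measurable_fun setT b).
Context (A : R) (A0 : 0 <= A) (m : int -> X -> R).
Hypothesis m_ball : forall g x y, padic_ball g x y -> m g x = m g y.
Hypothesis m_osc : forall g x,
  (\int[mu]_(y in padic_ball g x) `|b y - m g x|%:E <= (A * rho g `^ beta * vol g)%:E)%E.
Implicit Types (x y z : X) (g : int).

Let p1 : 1 < p%:R :> R.
Proof. by rewrite ltr1n prime_gt1. Qed.

Let p0 : 0 < p%:R :> R.
Proof. exact: lt_trans ltr01 p1. Qed.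

Let w : R := p%:R `^ beta.

Let w1 : 1 < w.
Proof.
have : (1 `^ beta < p%:R `^ beta :> R)%R by apply: gt0_ltr_powR; rewrite ?nnegrE.
by rewrite powR1.
Qed.

Let rb g : R := rho g `^ beta.

Let rb_gt0 g : 0 < rb g.
Proof. by rewrite powR_gt0 // rho_gt0. Qed.

Let rhoS g : rho (g + 1) = p%:R * rho g.
Proof. by rewrite expfzDr ?gt_eqF ?(lt_trans ltr01) // mulrC. Qed.

Let rbS g : rb (g + 1) = w * rb g.
Proof. by rewrite /rb rhoS powRM // ltW // rho_gt0. Qed.

Let rb_small (e : R) : 0 < e -> exists2 g : int, g <= 0 & rb g < e.
Proof.
move=> e0; pose t := e `^ beta^-1.
have t0 : 0 < t by exact: powR_gt0.
pose k := Num.bound t^-1; exists (- k%:Z); first by rewrite oppr_le0.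
have rt : rho (- k%:Z) < t.
  rewrite -invr_expz -[ltRHS]invrK ltf_pV2 ?posrE ?invr_gt0 ?exprz_gt0 //.
  apply: (@lt_le_trans _ _ (2 ^+ k)); first exact: upper_nthrootP.
  by rewrite -exprnP lerXn2r ?nnegrE ?ler_nat ?prime_gt1.
have te : t `^ beta = e by rewrite /t -powRrM mulVf ?gt_eqF // powRr1 // ltW.
by rewrite -te; apply: gt0_ltr_powR; rewrite ?nnegrE ?(ltW t0) ?(ltW (rho_gt0 _ _ _)).
Qed.

Let A2 : R := A * (1 + w * p%:R ^+ n).

Let m_step g x : `|m g x - m (g + 1) x| <= A2 * rb g.
Proof.
have v0 := vol_gt0 R hp n g.
have mB := measurable_padic_ball g x.
have mbc c : measurable_fun setT (fun y => `|b y - c|%:E).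
  apply/measurable_EFinP; apply: measurableT_comp => //.
  by apply: measurable_funB.
suff : ((`|m g x - m (g + 1) x| * vol g)%:E <=
   (A * rb g * vol g)%:E + (A * rb (g + 1) * vol (g + 1))%:E)%E.
  rewrite -EFinD lee_fin rbS rhoS exprMn => H.
  rewrite -(ler_pM2r v0); apply: (le_trans H).
  by rewrite /A2 le_eqVlt; apply/orP; left; apply/eqP; ring.
apply: (@le_trans _ _ (\int[mu]_(y in padic_ball g x) `|b y - m g x|%:E +
    \int[mu]_(y in padic_ball g x) `|b y - m (g + 1) x|%:E)%E); last first.
  apply: leeD; first exact: m_osc.
  apply: le_trans (m_osc (g + 1) x).
  apply: (@ge0_subset_integral _ _ _ _ (padic_ball g x)) => //.
  - exact: measurable_padic_ball.
  - exact: measurable_funTS.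
  - by apply: padic_ball_le; rewrite lerDl.
rewrite -ge0_integralD //; try exact: measurable_funTS.
rewrite EFinM -(haar_ball hmu g x) -(integral_cst _ mB).
apply: le_integral_nonneg => [y _|y _]; first by rewrite lee_fin.
rewrite -EFinD lee_fin -[leLHS]normrN.
have -> : - (m g x - m (g + 1) x) = (b y - m g x) - (b y - m (g + 1) x) by ring.
exact: ler_normB.
Qed.

Let D : R := A2 / (w - 1).

Let A2_ge0 : 0 <= A2.
Proof.
by rewrite mulr_ge0 // addr_ge0 // mulr_ge0 ?powR_ge0 ?exprn_ge0.
Qed.

Let D0 : 0 <= D.
Proof. by rewrite divr_ge0 // subr_ge0 ltW. Qed.

Let DA : D * (w - 1) = A2.
Proof. by rewrite divfK // gt_eqF // subr_gt0. Qed.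

(* Adding or subtracting D p ^ (g beta), with D the sum of the geometric series
   of the steps, makes the means monotone in g. *)
Let up g x : R := m g x + D * rb g.
Let lo g x : R := m g x - D * rb g.

Let up_homo x g g' : g <= g' -> up g x <= up g' x.
Proof.
apply: (int_homo (u := up^~ x)) => {}g; rewrite /up rbS.
have := m_step g x; rewrite -DA ler_norml => /andP[]; lra.
Qed.

Let lo_homo x g g' : g <= g' -> lo g' x <= lo g x.
Proof.
move=> gg; rewrite -lerN2; apply: (int_homo (u := fun g => - lo g x)) gg => {}g.
rewrite /lo rbS; have := m_step g x; rewrite -DA ler_norml => /andP[]; lra.
Qed.

Let lo_up x g g' : lo g x <= up g' x.
Proof.
have lu h : lo h x <= up h x.
  by rewrite /lo /up lerD2l ge0_cp // mulr_ge0 // ltW.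
have [gg|/ltW gg] := leP g g'; first by apply: le_trans (lu g) (up_homo x gg).
exact: le_trans (lo_homo x gg) (lu g').
Qed.

(** The common limit of the monotone families [up] and [lo] as g tends to minus
    infinity. *)
Definition campanato_limit x : R := inf [set up g x | g in setT].

Let G := campanato_limit.

Let G_near g x : `|G x - m g x| <= D * rb g.
Proof.
rewrite ler_distl; apply/andP; split.
  by apply: lb_le_inf; [exists (up 0 x), 0|move=> _ [g' _ <-]; exact: lo_up].
by apply: ge_inf; [exists (lo 0 x) => _ [g' _ <-]; exact: lo_up|exists g].
Qed.

Lemma campanato_limit_ge0 x : (forall g y, 0 <= m g y) -> 0 <= G x.
Proof.
move=> m0; apply: lb_le_inf; first by exists (up 0 x), 0.
by move=> _ [g _ <-]; rewrite addr_ge0 // mulr_ge0 // ltW.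
Qed.

Let G_ball g x y : padic_ball g x y -> `|G x - G y| <= 2 * D * rb g.
Proof.
move=> xy; have := G_near g x; have := G_near g y; rewrite (m_ball xy).
by rewrite !ler_norml => /andP[h1 h2] /andP[h3 h4]; apply/andP; split; lra.
Qed.

Lemma measurable_campanato_limit : measurable_fun setT G.
Proof.
apply/measurable_EFinP.
apply: (measurability _ (ErealGenOInfty.measurableE R)).
move=> /= _ [_ [c ->] <-]; rewrite setTI preimage_itvoy.
apply: sub_sigma_algebra; apply: locally_saturated_open => x /=.
rewrite lte_fin => cG.
have D1 : 0 < 2 * D + 1 by rewrite ltr_wpDl // mulr_ge0.
have e0 : 0 < (G x - c) / (2 * D + 1) by rewrite divr_gt0 ?subr_gt0.
have [g _ gs] := rb_small e0; exists g => y /G_ball.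
rewrite /= lte_fin ler_norml => /andP[_ h].
move: gs; rewrite ltr_pdivlMr // => gs.
have := rb_gt0 g; lra.
Qed.

Lemma campanato_limit_lipschitz : (lipschitz_seminorm beta G < +oo)%E.
Proof.
apply: (@le_lt_trans _ _ (2 * D * w)%:E); last exact: ltry.
apply: ge_ereal_sup => _ [[x y] /= xy <-]; rewrite lee_fin.
have t0 : 0 < padic_norm (x - y).
  rewrite lt_neqAle padic_norm_ge0 andbT eq_sym.
  by apply: contra_neq xy => /padic_norm_eq0 /eqP; rewrite subr_eq0 => /eqP.
have [g /andP[gt tg]] := rat_between_powers hp t0.
have h := G_ball (padic_ball_sym (tg : padic_ball (g + 1) y x)).
rewrite ler_pdivrMr ?powR_gt0 ?ltr0q //; apply: (le_trans h).
rewrite rbS mulrA; apply: ler_wpM2l; first exact: mulr_ge0 (mulr_ge0 (ler0n _ 2) D0) (ltW (lt_trans ltr01 w1)).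
apply: ge0_ler_powR; rewrite ?(ltW beta0) ?nnegrE ?ler0q ?(ltW t0) ?(ltW (rho_gt0 _ _ _)) //.
have <- : (ratr (p%:R ^ g) = rho g)%R by rewrite fmorphXz /= ratr_nat.
by rewrite ler_rat ltW.
Qed.

(** On a fixed large ball, the balls of radius p ^ g bound the integral of
    |b - G| by a constant times p ^ (g beta), for every g; it therefore vanishes. *)
Lemma campanato_limit_ae : ae_eq mu setT b G.
Proof.
have mG := measurable_campanato_limit.
have mbG : measurable_fun setT (fun y => (b y - G y)%:E).
  by apply/measurable_EFinP; exact: measurable_funB.
have mabs : measurable_fun setT (fun y => `|(b y - G y)%:E|%E) by exact: measurableT_comp.
pose E (N : nat) : set X := padic_ball N%:Z 0.
have mE N : measurable (E N) by exact: measurable_padic_ball.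
have small (N : nat) g : g <= 0 ->
    (\int[mu]_(y in E N) `|(b y - G y)%:E| <= ((A + D) * rb g * vol N%:Z)%:E)%E.
  move=> g0; have gN : g <= N%:Z by exact: le_trans g0 _.
  rewrite EFinM -(haar_ball hmu N%:Z 0) -(integral_cst _ (mE N)).
  apply: (ge0_le_integral_balls (saturated_ball gN)) => //.
  - exact: measurable_funTS.
  - by move=> x _; rewrite lee_fin mulr_ge0 ?addr_ge0 // ltW.
  move=> x _; have mB := measurable_padic_ball g x.
  rewrite integral_cst // haar_ball // -EFinM.
  apply: (@le_trans _ _ (\int[mu]_(y in padic_ball g x) (`|b y - m g x|%:E + (D * rb g)%:E))%E).
    apply: le_integral_nonneg => // y xy; rewrite -EFinD lee_fin.
    have := G_near g y; rewrite -(m_ball xy) distrC => H.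
    have -> : b y - G y = (b y - m g x) + (m g x - G y) by ring.
    by apply: le_trans (ler_normD _ _) _; rewrite lerD2l.
  rewrite ge0_integralD //.
  - rewrite integral_cst // haar_ball //; apply: (le_trans (leeD (m_osc g x) (lexx _))).
    by rewrite -EFinM -EFinD lee_fin -/(rb g) -mulrDl -mulrDl.
  - apply/measurable_EFinP; apply: measurableT_comp => //.
    by apply: measurable_funTS; exact: measurable_funB.
  - by move=> y _; rewrite lee_fin mulr_ge0 // ltW.
have null N : ae_eq mu (E N) (fun y => (b y - G y)%:E) (cst 0%E).
  apply/(ae_eq_integral_abs mu (mE N)); first exact: measurable_funTS.
  apply/eqP; rewrite eq_le integral_ge0 // andbT.
  apply/lee_addgt0Pr => e e0; rewrite add0e.
  have K0 : 0 < (A + D) * vol N%:Z + 1.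
    by rewrite ltr_wpDl // mulr_ge0 ?addr_ge0 // ltW // vol_gt0.
  have [g g0 gs] := rb_small (divr_gt0 e0 K0).
  apply: (le_trans (small N g g0)); rewrite lee_fin.
  move: gs; rewrite ltr_pdivlMr // => /ltW; apply: le_trans.
  by rewrite mulrAC mulrC ler_wpM2l ?lerDl // ltW.
have : {ae mu, forall x, forall N : nat, E N x -> (b x - G x)%:E = 0%E}.
  by apply/ae_foralln => N; exact: null.
apply: filterS => x H _; have [N xN] := padic_ball_cover x.
by have [/eqP] := H N xN; rewrite subr_eq0 => /eqP.
Qed.

Lemma campanato_lipschitz : lipschitz_space mu beta b.
Proof.
exists G; split; first exact: measurable_campanato_limit.
  exact: campanato_limit_lipschitz.
exact: campanato_limit_ae.
Qed.

Lemma campanato_ge0 : (forall g x, 0 <= m g x) -> {ae mu, forall x, 0 <= b x}.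
Proof.
move=> m0; apply: filterS campanato_limit_ae => x /(_ I) ->.
exact: campanato_limit_ge0.
Qed.

End Campanato.

Section OscillationToLipschitz.
Context (R : realType) (p : nat) (hp : prime p) (n : nat) (hn : (1 <= n)%N).
Local Notation X := (padic_space hp n).
Context (mu : {measure set X -> \bar R}) (hmu : normalized_haar mu).
Implicit Types (x y z : X) (g : int) (alpha beta q : R).
Local Open Scope ereal_scope.
Local Notation rho g := (p%:R ^ g : R)%R.
Local Notation vol g := (rho g ^+ n)%R.
Context (alpha beta q : R) (beta0 : (0 < beta)%R) (q1 : (1 < q)%R).
Context (b : X -> R) (mb : measurable_fun setT b).

Let osc g x y : \bar R := `|(b y)%:E - mu (padic_ball g x) `^ (- alpha / n%:R)
                          * frac_maximal_on mu (padic_ball g x) alpha b y|.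

Let q0 : (0 < q)%R := lt_trans ltr01 q1.

Lemma oscillation_integral_bound : frac_oscillation mu b alpha beta q < +oo ->
  exists2 K : R, (0 < K)%R & forall g x,
    \int[mu]_(y in padic_ball g x) (osc g x y `^ q) <=
    (vol g * (K * rho g `^ beta) `^ q)%:E.
Proof.
set O := frac_oscillation _ _ _ _ _ => Ooo.
have O0 : 0 <= O.
  apply: le_trans (ereal_sup_ubound _); last by exists (0%R, 0%R).
  by rewrite mule_ge0 ?inve_ge0 ?poweR_ge0.
have OE : O = (fine O)%:E by rewrite fineK // ge0_fin_numE.
have F0 : (0 <= fine O)%R by rewrite fine_ge0.
exists (fine O + 1)%R => [|g x]; first by rewrite ltr_wpDl.
have v0 := vol_gt0 R hp n g.
have r0 := rho_gt0 R hp g.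
set I := integral _ _ _.
have I0 : 0 <= I by apply: integral_ge0 => y _; exact: poweR_ge0.
have : (mu (padic_ball g x) `^ (beta / n%:R))^-1 *
      ((mu (padic_ball g x))^-1 * I) `^ q^-1 <= O.
  by apply: ereal_sup_ubound; exists (g, x).
rewrite haar_ball // poweR_EFin vol_powR // !inver !gt_eqF ?powR_gt0 // OE.
rewrite lee_pdivrMl ?powR_gt0 // => H.
have vI0 : 0 <= (vol g)^-1%:E * I by rewrite mule_ge0 // lee_fin invr_ge0 ltW.
set s : R := ((fine O + 1) * rho g `^ beta)%R.
have s0 : (0 <= s)%R by rewrite mulr_ge0 ?powR_ge0 // addr_ge0.
have {}H : ((vol g)^-1%:E * I) `^ q^-1 <= s%:E.
  apply: (le_trans H); rewrite -EFinM lee_fin mulrC ler_wpM2r ?powR_ge0 //.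
  by rewrite lerDl.
rewrite EFinM -lee_pdivrMl //.
have := @gt0_ler_poweR R q (ltW q0) _ _ _ _ H.
rewrite -poweRrM mulVf ?gt_eqF // poweRe1 // poweR_EFin; apply.
  by rewrite in_itv /= leey andbT poweR_ge0.
by rewrite in_itv /= leey andbT lee_fin.
Qed.

Hypothesis Ofin : frac_oscillation mu b alpha beta q < +oo.

(* If |b| had infinite integral on a ball, the local maximal function would be
   infinite on all of it, and so would the oscillation. *)
Let ball_finite g x : \int[mu]_(y in padic_ball g x) `|(b y)%:E| \is a fin_num.
Proof.
have [K K0 HK] := oscillation_integral_bound Ofin.
have mB := measurable_padic_ball g x.
have v0 := vol_gt0 R hp n g.
have I0 : 0 <= \int[mu]_(y in padic_ball g x) `|(b y)%:E| by exact: integral_ge0.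
rewrite ge0_fin_numE // ltey; apply/eqP => Ioo.
have Moo y : padic_ball g x y -> frac_maximal_on mu (padic_ball g x) alpha b y = +oo.
  move=> xy; apply/eqP; rewrite -leye_eq.
  have <- : mu (padic_ball g y) `^ (-1 + alpha / n%:R) *
      \int[mu]_(z in padic_ball g y) `|(b z)%:E| = +oo.
    rewrite -(padic_ball_eq xy) Ioo haar_ball // poweR_EFin gt0_muley //.
    by rewrite lte_fin powR_gt0.
  by apply: ereal_sup_ubound; exists g; [exact: padic_ball_sub | by []].
have := HK g x; rewrite (eq_integral (cst +oo)); last first.
  move=> y /set_mem xy; rewrite /osc (Moo y xy) haar_ball // poweR_EFin.
  by rewrite gt0_muley ?lte_fin ?powR_gt0 //= gt_eqF.
by rewrite integral_cst // haar_ball // gt0_mulye.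
Qed.

Let mean g x : R := (fine (\int[mu]_(y in padic_ball g x) `|(b y)%:E|) / vol g)%R.

Let meanE g x : \int[mu]_(y in padic_ball g x) `|(b y)%:E| = (mean g x * vol g)%:E.
Proof. by rewrite divfK ?fineK // gt_eqF // vol_gt0. Qed.

Let mean_ge0 g x : (0 <= mean g x)%R.
Proof. by rewrite divr_ge0 ?fine_ge0 ?integral_ge0 // ltW // vol_gt0. Qed.

(* The local maximal function dominates the average over the whole ball. *)
Let mean_le_osc g x y : padic_ball g x y ->
  (Num.max (mean g x - b y) 0)%:E <= osc g x y.
Proof.
move=> xy; have v0 := vol_gt0 R hp n g.
rewrite EFin_max ge_max abse_ge0 andbT /osc -[X in `|X|]oppeK abseN.
apply: le_trans (lee_abs _).
rewrite oppeB; last by apply: fin_num_adde_defr.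
rewrite addeC EFinB; apply: leeB => //.
apply: (@le_trans _ _ (mu (padic_ball g x) `^ (- alpha / n%:R) *
  (mu (padic_ball g y) `^ (-1 + alpha / n%:R) *
   \int[mu]_(z in padic_ball g y) `|(b z)%:E|))).
  rewrite -(padic_ball_eq xy) meanE !haar_ball // !poweR_EFin -!EFinM lee_fin.
  rewrite mulrA -powRD; last by rewrite (gt_eqF v0) implybT.
  have -> : (- alpha / n%:R + (-1 + alpha / n%:R) = -1)%R by rewrite mulNr; ring.
  by rewrite powR_inv1 ?(ltW v0) // mulrC mulfK // gt_eqF.
apply: lee_wpmul2l; first exact: poweR_ge0.
by apply: ereal_sup_ubound; exists g; [exact: padic_ball_sub | by []].
Qed.

(** One of the two summands bounds t, depending on whether t <= s. Integrated with
    s of the size of the q-th mean of t, this bounds the mean of t. *)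
Lemma le_add_scaled_powR (s t : R) : (0 < s)%R -> (0 <= t)%R ->
  (t <= s + s * (s^-1 `^ q * t `^ q))%R.
Proof.
move=> s0 t0; have [ts|/ltW st] := leP t s.
  by rewrite (le_trans ts) // lerDl !mulr_ge0 ?powR_ge0 // ltW.
rewrite -powRM ?invr_ge0 ?(ltW s0) //.
have : (s^-1 * t <= (s^-1 * t) `^ q)%R.
  by apply: le1r_powR; rewrite ?(ltW q1) // ler_pdivlMl // mulr1.
rewrite ler_pdivrMl // => h; apply: (le_trans h).
by rewrite lerDr ltW.
Qed.

Lemma dist_le_deficit (u v : R) : (`|u - v| + v <= `|u| + 2 * Num.max (v - u) 0)%R.
Proof.
have hu := ler_norm u; have [vu|uv] := leP v u.
  by rewrite ger0_norm ?subr_ge0 // max_r ?subr_le0 //; lra.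
by rewrite ltr0_norm ?subr_lt0 // max_l ?subr_ge0 ?(ltW uv) //; lra.
Qed.

(** The oscillation controls the part of b below the mean of |b|. Since the mean of
    b is at most that of |b|, the part of b above it is no larger in mean. *)
Lemma mean_oscillation_bound : exists2 A : R, (0 <= A)%R & forall g x,
  \int[mu]_(y in padic_ball g x) `|b y - mean g x|%:E <= (A * rho g `^ beta * vol g)%:E.
Proof.
have [K K0 HK] := oscillation_integral_bound Ofin.
exists (4 * K)%R => [|g x]; first by rewrite mulr_ge0 // ltW.
have mB := measurable_padic_ball g x.
have v0 := vol_gt0 R hp n g.
set s : R := (K * rho g `^ beta)%R.
have s0 : (0 < s)%R by rewrite mulr_gt0 // powR_gt0 // rho_gt0.
pose t y : R := Num.max (mean g x - b y)%R 0%R.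
have t0 y : (0 <= t y)%R by rewrite le_max lexx orbT.
have mt : measurable_fun setT t.
  by apply: measurable_maxr => //; apply: measurable_funB.
have mtq : measurable_fun setT (fun y => (t y `^ q)%:E).
  by apply/measurable_EFinP; exact: (measurableT_comp (measurable_powR q)).
have It : \int[mu]_(y in padic_ball g x) (t y)%:E <= (2 * s * vol g)%:E.
  apply: (@le_trans _ _ (\int[mu]_(y in padic_ball g x)
      (s%:E + (s * s^-1 `^ q)%:E * (t y `^ q)%:E))).
    apply: le_integral_nonneg => y _; first by rewrite lee_fin.
    by rewrite -EFinM -EFinD lee_fin -mulrA le_add_scaled_powR.
  have c0 : (0 <= s * s^-1 `^ q)%R by rewrite mulr_ge0 ?powR_ge0 // ltW.
  rewrite ge0_integralD //; first last.
  - by apply: measurable_funeM; exact: measurable_funTS.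
  - by move=> y _; rewrite -EFinM lee_fin mulr_ge0 ?powR_ge0.
  - by move=> y _; rewrite lee_fin ltW.
  rewrite integral_cst // haar_ball // ge0_integralZl_EFin //; first last.
  - exact: measurable_funTS.
  - by move=> y _; rewrite lee_fin powR_ge0.
  have H : \int[mu]_(y in padic_ball g x) (t y `^ q)%:E <= (vol g * s `^ q)%:E.
    apply: le_trans (HK g x); apply: le_integral_nonneg => y xy.
      by rewrite lee_fin powR_ge0.
    rewrite -poweR_EFin; apply: gt0_ler_poweR; rewrite ?(ltW q0) //.
    - by rewrite in_itv /= leey andbT lee_fin.
    - by rewrite in_itv /= leey andbT abse_ge0.
    - exact: mean_le_osc.
  apply: (le_trans (leeD (lexx _) (lee_wpmul2l _ H))); first by rewrite lee_fin.
  rewrite -!EFinM -EFinD lee_fin.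
  have -> : (s * s^-1 `^ q * (vol g * s `^ q) = s * vol g * (s^-1 `^ q * s `^ q))%R by ring.
  rewrite -powRM ?invr_ge0 ?(ltW s0) // mulVf ?gt_eqF // powR1.
  by rewrite le_eqVlt; apply/orP; left; apply/eqP; ring.
have mbm : measurable_fun setT (fun y => `|b y - mean g x|%:E).
  by apply/measurable_EFinP; apply: measurableT_comp => //; apply: measurable_funB.
have mabsb : measurable_fun setT (fun y => `|(b y)%:E|).
  by apply: measurableT_comp => //; exact/measurable_EFinP.
(* Both m and |b| integrate to the same finite value, which cancels. *)
have : \int[mu]_(y in padic_ball g x) (`|b y - mean g x|%:E + (mean g x)%:E) <=
    \int[mu]_(y in padic_ball g x) (`|(b y)%:E| + 2%:E * (t y)%:E).
  apply: le_integral_nonneg => y _; first by rewrite -EFinD lee_fin addr_ge0.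
  rewrite /= -EFinM -!EFinD lee_fin; exact: dist_le_deficit.
rewrite ge0_integralD //; [|exact: measurable_funTS|by move=> y _; rewrite lee_fin].
rewrite ge0_integralD //; first last.
- by apply: measurable_funeM; apply: measurable_funTS; exact/measurable_EFinP.
- by move=> y _; rewrite -EFinM lee_fin mulr_ge0.
- exact: measurable_funTS.
rewrite integral_cst // haar_ball // meanE ge0_integralZl_EFin //; first last.
- by apply: measurable_funTS; exact/measurable_EFinP.
- by move=> y _; rewrite lee_fin.
have I0 : 0 <= \int[mu]_(y in padic_ball g x) `|b y - mean g x|%:E by exact: integral_ge0.
have two0 : 0 <= 2%:E :> \bar R by rewrite lee_fin.
move=> H; have {H} := le_trans H (leeD (lexx _) (lee_wpmul2l two0 It)).
case: (\int[mu]_(y in padic_ball g x) `|b y - mean g x|%:E) I0 => [I| |] //.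
rewrite -!EFinM -!EFinD !lee_fin => _ H.
rewrite addrC lerD2l in H; apply: (le_trans H).
by rewrite le_eqVlt; apply/orP; left; apply/eqP; rewrite /s; ring.
Qed.

Lemma oscillation_lipschitz :
  lipschitz_space mu beta b /\ {ae mu, forall x, (0 <= b x)%R}.
Proof.
have [A A0 HA] := mean_oscillation_bound.
have mean_ball g x y : padic_ball g x y -> mean g x = mean g y.
  by move=> xy; rewrite /mean (padic_ball_eq xy).
split; first exact: (campanato_lipschitz hmu beta0 mb A0 mean_ball HA).
exact: (campanato_ge0 hmu beta0 mb A0 mean_ball HA).
Qed.

End OscillationToLipschitz.

(** * The equivalence *)

Theorem corollary1p1 (R : realType) (p : nat) (hp : prime p)
  (n : nat) (hn : (1 <= n)%N)
  (mu : {measure set (padic_space hp n) -> \bar R}) (hmu : normalized_haar mu)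
  (alpha beta : R) (hbeta : 0 < beta < 1)
  (halpha : 0 < alpha) (hlt : alpha < alpha + beta) (hsum : alpha + beta < n%:R)
  (b : padic_space hp n -> R) (hb : padic_locally_integrable mu b) :
  [<-> lipschitz_space mu beta b /\ {ae mu, forall x, 0 <= b x};
       forall r q : R, admissible_exponents n alpha beta r q ->
         bounded_Lfun mu r q (frac_commutator mu b alpha);
       exists r q : R, admissible_exponents n alpha beta r q /\
         bounded_Lfun mu r q (frac_commutator mu b alpha);
       exists r q : R, admissible_exponents n alpha beta r q /\
         (frac_oscillation mu b alpha beta q < +oo)%E;
       forall r q : R, admissible_exponents n alpha beta r q ->
         (frac_oscillation mu b alpha beta q < +oo)%E].
Proof.
have beta0 : 0 < beta by case/andP: hbeta.
have ab0 : 0 < alpha + beta by rewrite addr_gt0.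
have an : alpha < n%:R by exact: lt_trans hlt hsum.
have mb : measurable_fun setT b by case: hb.
have [r0 [q0 rq0]] := admissible_exponents_exist ab0 hsum.
have bounded : lipschitz_space mu beta b /\ {ae mu, forall x, 0 <= b x} ->
    forall r q, admissible_exponents n alpha beta r q ->
    bounded_Lfun mu r q (frac_commutator mu b alpha).
  by move=> [bL b0] r q; exact: lipschitz_commutator_bounded.
have oscillation r q : admissible_exponents n alpha beta r q ->
    bounded_Lfun mu r q (frac_commutator mu b alpha) ->
    (frac_oscillation mu b alpha beta q < +oo)%E.
  move=> /(admissible_exponents_gt1 hn ab0)[r1 q1 qE].
  by apply: bounded_commutator_oscillation => //; exact: lt_trans ltr01 q1.
have lipschitz r q : admissible_exponents n alpha beta r q ->
    (frac_oscillation mu b alpha beta q < +oo)%E ->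
    lipschitz_space mu beta b /\ {ae mu, forall x, 0 <= b x}.
  move=> /(admissible_exponents_gt1 hn ab0)[_ q1 _].
  exact: oscillation_lipschitz.
tfae.
- exact: bounded.
- by move=> H; exists r0, q0; split=> //; exact: (H r0 q0 rq0).
- by move=> [r [q [rq H]]]; exists r, q; split=> //; exact: oscillation rq H.
- move=> [r [q [rq H]]] r' q' rq'.
  exact: oscillation rq' (bounded (lipschitz r q rq H) r' q' rq').
- by move=> H; exact: lipschitz rq0 (H r0 q0 rq0).
Qed.
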